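(* For every positive integer $d$ and all $r>0$, $R>0$, $\nu\ge1$, $\sigma>0$ there is a constant $c(d,r,R,\nu,\sigma)>0$, depending only on the indicated parameters, such that the following holds. Let $D\subset\mathbb{R}^d$ be a convex body which contains a ball of radius $r$ and is contained in a ball of radius $R$. Let $\boldsymbol{x}\in D\setminus\partial D$, and let $\boldsymbol{u}\in\mathbb{R}^d$ be a unit vector such that $$\delta:=\max\{t:\boldsymbol{x}+t\boldsymbol{u}\in D\}\le\nu\,\mathrm{dist}(\boldsymbol{x},\partial D)$$ and such that the hyperplane passing through $\boldsymbol{x}+\delta\boldsymbol{u}$ with normal vector $\boldsymbol{u}$ is supporting to $D$. Let $n$ be a positive integer. If $\delta\ge\sigma n^{-2}$, then $$\lambda_n(D,\boldsymbol{x})\le c(d,r,R,\nu,\sigma)\,n^{-d}\min\left\{\sqrt{\delta},\ \delta^{1-d/2}\,\mathrm{Vol}_{d-1}(\{\boldsymbol{y}\in D:(\boldsymbol{x}-\boldsymbol{y})\perp\boldsymbol{u}\})\right\}.$$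
   Context: A convex body is a convex compact set with non-empty interior; $\partial D$ is the boundary of $D$; $\mathrm{dist}(\boldsymbol{x},Y)=\inf\{|\boldsymbol{x}-\boldsymbol{y}|:\boldsymbol{y}\in Y\}$ with $|\cdot|$ the Euclidean norm; $\mathrm{Vol}_k$ is the $k$-dimensional volume. Let $\mathcal{P}_{n,d}$ be the space of all real algebraic polynomials of total degree $\le n$ in $d$ variables. For a compact set $D\subset\mathbb{R}^d$ with non-empty interior, the Christoffel function (with uniform weight) is $\lambda_n(D,\boldsymbol{x})=\left(\sum_{k=1}^N\varphi_k(\boldsymbol{x})^2\right)^{-1}$, $\boldsymbol{x}\in D$, where $\{\varphi_k\}_{k=1}^N$ is an orthonormal basis of $\mathcal{P}_{n,d}$ with respect to $\langle f,g\rangle=\int_D f(\boldsymbol{y})g(\boldsymbol{y})\,d\boldsymbol{y}$. Equivalently, $\lambda_n(D,\boldsymbol{x})=\min\{\int_D f^2(\boldsymbol{y})\,d\boldsymbol{y}: f\in\mathcal{P}_{n,d},\ |f(\boldsymbol{x})|=1\}$. *)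

(* Defs.v *)
From HB Require Import structures.
From mathcomp Require Import all_boot all_order all_algebra.
From mathcomp Require Import all_classical all_reals all_analysis.
(* The notations of mpoly clash with those of mathcomp-analysis. *)
From mathcomp Require mpoly.
Import (canonicals, coercions) mpoly.

Set Implicit Arguments.
Unset Strict Implicit.
Unset Printing Implicit Defensive.

Import Order.TTheory GRing.Theory Num.Theory.
Import numFieldNormedType.Exports.

Local Open Scope classical_set_scope.
Local Open Scope ring_scope.

(* The sigma-algebra of row vectors is the one generated by the coordinates,
   as the library does for tuples; on ['rV[R]_n] it is the Borel one. *)
Definition rV_display (d : measure_display) : measure_display.
Proof. exact. Qed.

Section measurable_rV.
Context {d : measure_display} {T : measurableType d}.
Variable n : nat.

Definition rV_coord (i : 'I_n) (x : 'rV[T]_n) : T := x ord0 i.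

Let rV_set0 : g_sigma_preimage rV_coord set0.
Proof. exact: sigma_algebra0. Qed.

Let rV_setC A : g_sigma_preimage rV_coord A -> g_sigma_preimage rV_coord (~` A).
Proof. exact: sigma_algebraC. Qed.

Let rV_bigcup (F : (set 'rV[T]_n)^nat) :
  (forall i, g_sigma_preimage rV_coord (F i)) ->
  g_sigma_preimage rV_coord (\bigcup_i (F i)).
Proof. exact: sigma_algebra_bigcup. Qed.

HB.instance Definition _ := @isMeasurable.Build (rV_display d)
  'rV[T]_n (g_sigma_preimage rV_coord) rV_set0 rV_setC rV_bigcup.

End measurable_rV.

Lemma measurable_rV_coord d (T : measurableType d) n (i : 'I_n) :
  measurable_fun [set: 'rV[T]_n] (rV_coord i).
Proof.
move=> _ Y mY; rewrite setTI; apply: sub_sigma_algebra => /=.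
rewrite -bigcup_seq/=; exists i => /=; first by rewrite mem_index_enum.
by exists Y => //; rewrite setTI.
Qed.

Lemma measurable_fun_rVP d1 d2 (T1 : measurableType d1) (T2 : measurableType d2)
    n (f : T1 -> 'rV[T2]_n) :
  (forall i, measurable_fun [set: T1] (rV_coord i \o f)) ->
  measurable_fun [set: T1] f.
Proof.
move=> mf.
suff sub : g_sigma_preimage (@rV_coord _ T2 n) `<=`
    [set A | measurable (f @^-1` A)].
  by move=> _ A mA; rewrite setTI; exact: sub.
apply: smallest_sub.
  split=> [|A|F].
  - by rewrite /= preimage_set0.
  - by rewrite /= setTD -preimage_setC => mA; apply: measurableC.
  - by rewrite /= preimage_bigcup => mF; apply: bigcup_measurable => k _; exact: mF.
rewrite -bigcup_seq/= => A [i _ [B mB <-]] /=.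
by rewrite setTI -comp_preimage -[X in measurable X]setTI; exact: mf.
Qed.

(* The sigma-finite instance of the library on [m1 \x m2] is not found by
   unification when [m1] or [m2] is not a finite measure. *)
Lemma sigma_finite_product d1 d2 (T1 : measurableType d1)
    (T2 : measurableType d2) (R : realType)
    (m1 : {sigma_finite_measure set T1 -> \bar R})
    (m2 : {sigma_finite_measure set T2 -> \bar R}) :
  sigma_finite setT (m1 \x m2)%E.
Proof.
have /sigma_finiteP[F [TF ndF Foo]] := sigma_finiteT m1.
have /sigma_finiteP[G [TG ndG Goo]] := sigma_finiteT m2.
exists (fun n => F n `*` G n).
  rewrite -setXTT TF TG predeqE => -[x y]; split.
    move=> [/= [n _ Fnx] [k _ Gky]]; exists (maxn n k) => //; split.
    - by move: x Fnx; exact/subsetPset/ndF/leq_maxl.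
    - by move: y Gky; exact/subsetPset/ndG/leq_maxr.
  by move=> [n _ []/= ? ?]; split; exists n.
move=> k; have [? ?] := Foo k; have [? ?] := Goo k.
split; first exact: measurableX.
by rewrite product_measure1E// lte_mul_pinfty// ge0_fin_numE.
Qed.

Section cons_rV.
Context {R : realType} {n : nat}.

Definition cons_rV (p : R * 'rV[R]_n) : 'rV[R]_n.+1 :=
  row_mx (p.1)%:M p.2 : 'rV_(1 + n).

Definition uncons_rV (x : 'rV[R]_n.+1) : R * 'rV[R]_n :=
  (x ord0 ord0, \row_j x ord0 (lift ord0 j)).

Lemma cons_rV0 p : cons_rV p ord0 ord0 = p.1.
Proof.
have -> : ord0 = lshift n (ord0 : 'I_1) :> 'I_(1 + n) by exact/val_inj.
by apply: (etrans (row_mxEl _ _ _ _)); rewrite mxE eqxx mulr1n.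
Qed.

Lemma cons_rVS p (j : 'I_n) : cons_rV p ord0 (lift ord0 j) = p.2 ord0 j.
Proof.
have -> : lift ord0 j = rshift 1 j :> 'I_(1 + n) by exact/val_inj.
exact: row_mxEr.
Qed.

Lemma cons_rVK : cancel cons_rV uncons_rV.
Proof.
move=> p; rewrite /uncons_rV cons_rV0 [RHS]surjective_pairing; congr pair.
by apply/rowP => j; rewrite mxE cons_rVS.
Qed.

Lemma measurable_cons_rV : measurable_fun setT cons_rV.
Proof.
apply: measurable_fun_rVP => i; case: (unliftP ord0 i) => [j ->|->].
- rewrite (_ : _ \o _ = rV_coord j \o snd).
    by apply: measurableT_comp => //; exact: measurable_rV_coord.
  by apply/funext => p /=; rewrite /rV_coord cons_rVS.
- rewrite (_ : _ \o _ = fst) //.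
  by apply/funext => p /=; rewrite /rV_coord cons_rV0.
Qed.

Lemma measurable_uncons_rV : measurable_fun setT uncons_rV.
Proof.
apply/measurable_fun_pairP; split.
- exact: (measurable_rV_coord (ord0 : 'I_n.+1)).
- apply: measurable_fun_rVP => j.
  rewrite (_ : _ \o _ = rV_coord (lift ord0 j)); first exact: measurable_rV_coord.
  by apply/funext => x /=; rewrite /rV_coord mxE.
Qed.

Variable mu : {sigma_finite_measure set 'rV[R]_n -> \bar R}.

Definition lebesgue_cons : set 'rV[R]_n.+1 -> \bar R :=
  pushforward (lebesgue_measure \x mu)%E cons_rV.

Let lebesgue_cons0 : lebesgue_cons set0 = 0%E.
Proof. by rewrite /lebesgue_cons /pushforward preimage_set0 measure0. Qed.

Let lebesgue_cons_ge0 A : (0 <= lebesgue_cons A)%E.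
Proof. by rewrite /lebesgue_cons /pushforward; exact: measure_ge0. Qed.

Let lebesgue_cons_sigma_additive : semi_sigma_additive lebesgue_cons.
Proof.
have mf := measurable_cons_rV.
move=> F mF tF mUF; rewrite /lebesgue_cons /pushforward preimage_bigcup.
apply: measure_semi_sigma_additive.
- by move=> k; rewrite -[X in measurable X]setTI; exact: mf.
- apply/trivIsetP => /= i j _ _ ij; rewrite -preimage_setI.
  by move/trivIsetP : tF => /(_ _ _ _ _ ij) ->//; rewrite preimage_set0.
- by rewrite -preimage_bigcup -[X in measurable X]setTI; exact: mf.
Qed.

HB.instance Definition _ := isMeasure.Build _ _ _
  lebesgue_cons lebesgue_cons0 lebesgue_cons_ge0 lebesgue_cons_sigma_additive.

Let lebesgue_cons_sigma_finite : sigma_finite setT lebesgue_cons.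
Proof.
have [F FT Foo] := sigma_finite_product lebesgue_measure mu.
exists (fun k => uncons_rV @^-1` F k).
  by rewrite -preimage_bigcup -FT preimage_setT.
move=> k; have [mF muF] := Foo k; split.
  by rewrite -[X in measurable X]setTI; exact: measurable_uncons_rV.
rewrite /lebesgue_cons /pushforward -comp_preimage.
rewrite (_ : uncons_rV \o cons_rV = id)//.
by apply/funext => p /=; rewrite cons_rVK.
Qed.

HB.instance Definition _ := Measure_isSigmaFinite.Build _ _ _
  lebesgue_cons lebesgue_cons_sigma_finite.

End cons_rV.

Arguments lebesgue_cons {R n} mu.

Section lebesgue_rV.
Context {R : realType}.

Fixpoint lebesgue_rV (n : nat) : {sigma_finite_measure set 'rV[R]_n -> \bar R} :=
  match n with
  | 0 => dirac (0 : 'rV[R]_0)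
  | m.+1 => lebesgue_cons (lebesgue_rV m)
  end.

Lemma lebesgue_rV_box n (a b : 'rV[R]_n) : (forall i, a ord0 i <= b ord0 i) ->
  lebesgue_rV n [set x | forall i, a ord0 i <= x ord0 i <= b ord0 i] =
  (\prod_(i < n) (b ord0 i - a ord0 i))%:E.
Proof.
elim: n a b => [|n IH] a b ab.
  rewrite big_ord0 /= diracE mem_set//= => -[]//.
rewrite big_ord_recl.
pose tl (x : 'rV[R]_n.+1) : 'rV[R]_n := \row_j x ord0 (lift ord0 j).
pose box := [set x : 'rV[R]_n | forall i, tl a ord0 i <= x ord0 i <= tl b ord0 i].
have boxE : cons_rV @^-1` [set x | forall i, a ord0 i <= x ord0 i <= b ord0 i] =
    `[a ord0 ord0, b ord0 ord0]%classic `*` box.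
  apply/seteqP; split => -[t y] /=.
  - move=> H; split; first by rewrite ?in_itv/=; have := H ord0; rewrite cons_rV0.
    by move=> i; have := H (lift ord0 i); rewrite cons_rVS !mxE.
  - move=> [t_ab y_ab] i; case: (unliftP ord0 i) => [j ->|->].
      by have := y_ab j; rewrite cons_rVS !mxE.
    by rewrite cons_rV0; move: t_ab; rewrite /= ?in_itv.
have mbox : measurable box.
  rewrite (_ : box = \bigcap_(i in [set: 'I_n])
      (rV_coord i @^-1` `[tl a ord0 i, tl b ord0 i]%classic)).
    apply: fin_bigcap_measurable => // i _.
    by rewrite -[X in measurable X]setTI; exact: measurable_rV_coord.
  apply/seteqP; split => x /= xab i; first by move=> _; rewrite /= in_itv/=; exact: xab.
  by have := xab i Logic.I; rewrite /= in_itv.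
transitivity ((lebesgue_measure \x lebesgue_rV n)%E
    (`[a ord0 ord0, b ord0 ord0]%classic `*` box)); first by rewrite -boxE.
rewrite product_measure1E//= IH; last by move=> i; rewrite !mxE.
rewrite lebesgue_measure_itv/= lte_fin.
have := ab ord0; rewrite le_eqVlt => /predU1P[->|->].
  by rewrite ltxx subrr mul0r mul0e.
by rewrite -EFinB -EFinM; congr (_ * _)%:E; apply: eq_bigr => i _; rewrite !mxE.
Qed.

End lebesgue_rV.
Arguments lebesgue_rV : clear implicits.

Section euclidean.
Context {R : realType} {d : nat}.
Implicit Types (x y u p : 'rV[R]_d) (D Y : set 'rV[R]_d).

Definition dotv x y : R := (x *m y^T) ord0 ord0.

(* The norm [`|x|] of the library on row vectors is the supremum norm. *)
Definition enorm x : R := Num.sqrt (dotv x x).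

Definition eball x (rho : R) : set 'rV[R]_d := [set y | enorm (y - x) <= rho].

Definition dist_set x Y : R := inf [set enorm (x - y) | y in Y].

Definition boundary D : set 'rV[R]_d := closure D `\` interior D.

Definition convex_body D := [/\ convex_set D, compact D & interior D !=set0].

Definition hyperplane p u : set 'rV[R]_d := [set y | dotv (y - p) u = 0].

Definition supporting_hyperplane D p u :=
  D `&` hyperplane p u !=set0 /\
  (D `<=` [set y | dotv (y - p) u <= 0] \/ D `<=` [set y | 0 <= dotv (y - p) u]).

Definition hyperplane_section D x u : set 'rV[R]_d :=
  D `&` [set y | dotv (x - y) u = 0].

(* The rows of [B] form an orthonormal basis of the orthogonal complement of
   the unit vector [u]. *)
Definition orthonormal_frame u (B : 'M[R]_(d.-1, d)) :=
  B *m B^T = 1%:M /\ B *m u^T = 0.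

(* The (d-1)-dimensional volume of a set [S] contained in the hyperplane
   [p + rowspace B], through the isometry [z |-> p + z *m B]. The value does
   not depend on the choice of [p] in the hyperplane nor on the orthonormal
   frame [B]. *)
Definition hyperplane_volume p (B : 'M[R]_(d.-1, d)) (S : set 'rV[R]_d) : \bar R :=
  lebesgue_rV R d.-1 [set z | S (p + z *m B)].

End euclidean.

Definition is_max {R : realType} (A : set R) (m : R) := A m /\ ubound A m.

Section christoffel.
Context {R : realType} {d : nat}.
Implicit Types (p q : mpoly.mpoly d R) (D : set 'rV[R]_d).

Definition peval p (x : 'rV[R]_d) : R := mpoly.meval (fun i => x ord0 i) p.

(* [mpoly.msize p] is one plus the total degree of [p], and 0 if [p = 0]. *)
Definition polys_le (n : nat) : set (mpoly.mpoly d R) :=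
  [set p | (mpoly.msize p <= n.+1)%N].

Definition L2dot D p q : R :=
  (\int[lebesgue_rV R d]_(y in D) (peval p y * peval q y))%R.

Definition orthonormal_basis D (n N : nat) (phi : 'I_N -> mpoly.mpoly d R) :=
  [/\ forall k, polys_le n (phi k),
      forall j k, L2dot D (phi j) (phi k) = (j == k)%:R &
      forall p, polys_le n p -> exists a : 'I_N -> R, p = \sum_k a k *: phi k].

(* The value of [\lambda_n(D, x)] computed from an orthonormal basis [phi]; it
   is the same for all of them. *)
Definition christoffel N (phi : 'I_N -> mpoly.mpoly d R) (x : 'rV[R]_d) : R :=
  (\sum_k peval (phi k) x ^+ 2)^-1.

End christoffel.

(* Main.v *)
(* Sharply peaked polynomials bound the Christoffel function from above. The sum
   of the squares of a Dirichlet kernel at [(s - s0) / 2] and [(s + s0) / 2], with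
   [s = sqrt t], is a polynomial [p] in [t] of degree at most [n / d] with
   [p t0 >= 1] and [p t ^ 2 <= C / (1 + n^2 (t - t0)^2 / t0)] on a bounded
   interval [0, C0], as long as [t0 >= sg / n^2]: near the endpoint 0 it lives on
   the scale [sqrt t0 / n]. Multiplying [d] of these, composed with [d] independent
   affine functions [l_j] that map [D] into [0, C0], and integrating over the whole
   space gives [lambda_n (D, x) <= C n^-d prod_j sqrt (l_j x) / |det l|].
   Let [t] be the depth below the supporting hyperplane, so [t x = delta], and [z]
   the lateral coordinates. The functions [t] and [z_j + 3 Rad] give the bound
   [sqrt delta]. For the second bound choose vectors [v_j] in the section
   [K = D `&` {t = delta}], seen from [x], nearly maximizing [|det v|]; then the
   coordinates [m_j] of a point of [K] in the basis [v] are at most 2, and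
   convexity yields [|m_j z| <= 2 kappa (1 + t / delta)] on all of [D]. So
   [l_j = delta m_j / (2 kappa) + t + delta] is nonnegative on [D], with
   [l_j x = 2 delta], and [|det v|] is controlled by the volume of [K], which contains
   a parallelepiped spanned by multiples of the [v_j]. *)
Require Import Defs.
From mathcomp Require Import all_boot all_order all_algebra.
From mathcomp Require Import all_classical all_reals all_analysis.
From mathcomp Require Import perm measurable_realfun.
From mathcomp Require Import zify ring lra.
From mathcomp Require mpoly.
Import (canonicals, coercions) mpoly.

Set Implicit Arguments.
Unset Strict Implicit.
Unset Printing Implicit Defensive.

Import Order.TTheory GRing.Theory Num.Theory.
Import numFieldNormedType.Exports.

Local Open Scope classical_set_scope.
Local Open Scope ring_scope.

(** * Linear changes of variables for [lebesgue_rV] *)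

(** Uniqueness of Lebesgue measure: $|a|$ times the image of [mu] under [phi] has the right value on
    half-open intervals, hence equals [mu], and integrating against an image measure is a change of
    variables. *)
Lemma ge0_integral_affine (R : realType) (a b : R) (f : R -> \bar R) :
  a != 0 -> measurable_fun setT f -> (forall t, 0 <= f t)%E ->
  (\int[lebesgue_measure]_t f (a * t + b)%R =
   (`|a|^-1)%:E * \int[lebesgue_measure]_t f t)%E.
Proof.
move=> a0 mf f0.
pose mu := @lebesgue_measure R.
pose phi (t : measurableTypeR R) : measurableTypeR R := a * t + b.
have mphi : measurable_fun setT phi.
  by apply: measurable_funD => //; apply: measurable_funM.
pose m := measure_function_pushforward__canonical__measure_function_Measure mu mphi.
have mE A : measurable A -> mu A = mscale `|a|%:nng m A.
  apply: lebesgue_measure_unique => X /ocitvP[->|[[s t] /= st ->]].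
    by rewrite !measure0.
  rewrite lebesgue_measure_itv/= lte_fin st/= /mscale /= /pushforward.
  have [a_gt0|a_lt0|a_eq0] := ltgtP 0 a; last by rewrite -a_eq0 eqxx in a0.
  - rewrite (_ : phi @^-1` _ = `](s - b) / a, (t - b) / a]%classic); last first.
      apply/seteqP; split=> y /=; rewrite !in_itv/= ltr_pdivrMr// ler_pdivlMr//;
        by rewrite /phi mulrC ltrBlDr lerBrDr.
    rewrite lebesgue_measure_itv/= lte_fin ltr_pM2r ?invr_gt0// ltrD2r st.
    by rewrite -EFinB -!EFinM gtr0_norm//; congr EFin; field; rewrite a0.
  (* A negative slope reverses the interval, so the open end moves to the right; the length is
     unaffected. *)
  - rewrite (_ : phi @^-1` _ = `[(t - b) / a, (s - b) / a[%classic); last first.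
      apply/seteqP; split=> y /=; rewrite !in_itv/= ler_ndivrMr// ltr_ndivlMr//;
        by rewrite /phi mulrC ltrBlDr lerBrDr andbC.
    rewrite lebesgue_measure_itv/= lte_fin ltr_nM2r ?invr_lt0// ltrD2r st.
    by rewrite -EFinB -!EFinM ltr0_norm//; congr EFin; field; rewrite a0.
rewrite [in RHS](eq_measure_integral (mscale `|a|%:nng m)); last by move=> A mA _; exact: mE.
rewrite ge0_integral_mscale//= muleA -EFinM mulVf ?normr_eq0// mul1e.
by rewrite ge0_integral_pushforward.
Qed.

Section integral_rV.
Context {R : realType}.
Local Notation mu n := (lebesgue_rV R n).

Lemma measurable_affine_rV m n (A : 'M[R]_(m, n)) (b : 'rV[R]_n) :
  measurable_fun [set: 'rV[R]_m] (fun y : 'rV[R]_m => y *m A + b : 'rV[R]_n).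
Proof.
apply: measurable_fun_rVP => i.
rewrite (_ : _ \o _ = (fun y : 'rV[R]_m => \sum_j y ord0 j * A j i + b ord0 i)).
  apply: measurable_funD => //; apply: measurable_sum => j.
  by apply: measurable_funM => //; exact: (measurable_rV_coord j).
by apply/funext => y /=; rewrite /rV_coord !mxE.
Qed.

Lemma cons_rVE n (p : R * 'rV[R]_n) :
  cons_rV p = row_mx p.1%:M p.2 :> 'rV_(1 + n).
Proof. by []. Qed.

Lemma ge0_integral_cons_rV n (f : 'rV[R]_n.+1 -> \bar R) :
  measurable_fun setT f -> (forall y, 0 <= f y)%E ->
  (\int[mu n.+1]_y f y =
   \int[(lebesgue_measure \x mu n)%E]_p (f \o cons_rV) p)%E.
Proof.
move=> mf f0.
have mcons : @measurable_fun _ _ (measurableTypeR R * 'rV[R]_n)%type _ setT (@cons_rV R n).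
  exact: measurable_cons_rV.
have := ge0_integral_pushforward mcons (lebesgue_measure \x mu n)%E
  measurableT mf (fun _ _ => f0 _).
by rewrite preimage_setT.
Qed.

Lemma ge0_integral_rV_fubini1 n (f : 'rV[R]_n.+1 -> \bar R) :
  measurable_fun setT f -> (forall y, 0 <= f y)%E ->
  (\int[mu n.+1]_y f y =
   \int[lebesgue_measure]_t \int[mu n]_y f (cons_rV (t, y)))%E.
Proof.
move=> mf f0; rewrite ge0_integral_cons_rV// fubini_tonelli1//.
  exact: measurableT_comp mf measurable_cons_rV.
by move=> p; exact: f0.
Qed.

Lemma ge0_integral_rV_fubini2 n (f : 'rV[R]_n.+1 -> \bar R) :
  measurable_fun setT f -> (forall y, 0 <= f y)%E ->
  (\int[mu n.+1]_y f y =
   \int[mu n]_y \int[lebesgue_measure]_t f (cons_rV (t, y)))%E.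
Proof.
move=> mf f0; rewrite ge0_integral_cons_rV// fubini_tonelli2//.
  exact: measurableT_comp mf measurable_cons_rV.
by move=> p; exact: f0.
Qed.

Lemma measurable_cons_rVl n (y : 'rV[R]_n) :
  measurable_fun [set: measurableTypeR R] (fun t : measurableTypeR R => cons_rV (t, y)).
Proof. exact: measurableT_comp measurable_cons_rV (measurable_fun_pair _ _). Qed.

Lemma measurable_cons_rVr n (t : R) :
  measurable_fun [set: 'rV[R]_n] (fun y => cons_rV (t, y)).
Proof. exact: measurableT_comp measurable_cons_rV (measurable_fun_pair _ _). Qed.

(** The change of variables as a property of [A], inherited by products. Quantifying over [b] lets
    the block lemmas absorb the shifts produced by the coordinates that are held fixed. *)
Definition affine_jacobian n (A : 'M[R]_n) :=
  forall (b : 'rV[R]_n) (f : 'rV[R]_n -> \bar R),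
    measurable_fun setT f -> (forall y, 0 <= f y)%E ->
    (\int[mu n]_y f (y *m A + b)%R = (`|\det A|^-1)%:E * \int[mu n]_y f y)%E.

Lemma affine_jacobianM n (A B : 'M[R]_n) :
  affine_jacobian A -> affine_jacobian B -> affine_jacobian (A *m B).
Proof.
move=> hA hB b f mf f0.
under eq_integral do rewrite mulmxA -[_ *m A]addr0.
rewrite (hA 0 (fun z => f (z *m B + b)))//; last first.
  exact: measurableT_comp mf (measurable_affine_rV B b).
by rewrite hB// muleA -EFinM det_mulmx normrM invfM.
Qed.

Lemma cons_rV_affine_block n (a : R) (w : 'rV[R]_n) (c : 'cV[R]_n) (B : 'M[R]_n)
    (b : 'rV[R]_n.+1) t y :
  cons_rV (t, y) *m (block_mx a%:M w c B : 'M[R]_(1 + n)) + b =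
  cons_rV (a * t + ((y *m c) ord0 ord0 + b ord0 ord0),
           y *m B + (t *: w + (uncons_rV b).2)).
Proof.
have E : cons_rV (t, y) *m (block_mx a%:M w c B : 'M[R]_(1 + n)) =
    cons_rV (a * t + (y *m c) ord0 ord0, t *: w + y *m B).
  rewrite -[LHS]/(row_mx t%:M y *m block_mx a%:M w c B) mul_row_block.
  rewrite cons_rVE; congr row_mx.
    by rewrite -scalar_mxM {1}[y *m c]mx11_scalar -raddfD/= mulrC.
  by rewrite mul_scalar_mx.
rewrite E; apply/rowP => i; case: (unliftP ord0 i) => [j|] ->.
  by rewrite mxE !cons_rVS/= !mxE -addrA addrCA.
by rewrite mxE !cons_rV0/= addrA.
Qed.

(** Integrate over [y] first: for fixed [t] the term [t *: w] is a mere translation of [y], and what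
    remains is an affine substitution in [t] alone. *)
Lemma affine_jacobian_ublock n (a : R) (w : 'rV[R]_n) (B : 'M[R]_n) :
  a != 0 -> affine_jacobian B ->
  affine_jacobian (block_mx a%:M w 0 B : 'M[R]_(1 + n)).
Proof.
move=> a0 hB b f mf f0.
rewrite det_ublock det_scalar1 normrM invfM EFinM.
rewrite ge0_integral_rV_fubini1//; last first.
  exact: (measurableT_comp mf (measurable_affine_rV _ b)).
have mfr t := measurableT_comp mf (measurable_cons_rVr t).
transitivity (\int[lebesgue_measure]_t ((`|\det B|^-1)%:E *
    \int[mu n]_y f (cons_rV (a * t + b ord0 ord0, y)%R)))%E.
  apply: eq_integral => t _.
  under eq_integral do rewrite cons_rV_affine_block mulmx0 mxE add0r.
  by rewrite (hB _ (fun y => f (cons_rV (_, y))))//; exact: mfr.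
have mF : measurable_fun setT
    (fun t : measurableTypeR R => \int[mu n]_y f (cons_rV (t, y)))%E.
  apply: (@measurable_fun_fubini_tonelli_F _ _ _ _ _ (mu n) (f \o cons_rV)) => //.
    exact: measurableT_comp mf measurable_cons_rV.
  by move=> p; exact: f0.
have F0 t : (0 <= \int[mu n]_y f (cons_rV (t, y)))%E by exact: integral_ge0.
rewrite ge0_integralZl ?lee_fin//; last first.
  apply: (measurableT_comp mF).
  by apply: measurable_funD => //; apply: measurable_funM.
rewrite (ge0_integral_affine _ a0 mF F0) ge0_integral_rV_fubini1//.
by rewrite muleCA muleA.
Qed.

(** Here the shear translates [t] by an amount depending on [y], so [t] is integrated first. The
    hypothesis on the identity is translation invariance in dimension [n]. *)
Lemma affine_jacobian_lblock n (c : 'cV[R]_n) :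
  affine_jacobian (1%:M : 'M[R]_n) ->
  affine_jacobian (block_mx 1%:M 0 c 1%:M : 'M[R]_(1 + n)).
Proof.
move=> h1 b f mf f0.
rewrite det_lblock !det1 mulr1 normr1 invr1 mul1e.
rewrite ge0_integral_rV_fubini2//; last first.
  exact: (measurableT_comp mf (measurable_affine_rV _ b)).
transitivity (\int[mu n]_y
    \int[lebesgue_measure]_t f (cons_rV (t, y *m 1%:M + (uncons_rV b).2)%R))%E.
  apply: eq_integral => y _.
  under eq_integral do rewrite cons_rV_affine_block scaler0 add0r.
  rewrite (ge0_integral_affine (f := fun t => f (cons_rV (t, _))) _ (oner_neq0 R))//.
    by rewrite normr1 invr1 mul1e.
  exact: measurableT_comp mf (measurable_cons_rVl _).
have mG : measurable_fun setT
    (fun y => \int[lebesgue_measure]_t f (cons_rV (t, y)))%E.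
  apply: (@measurable_fun_fubini_tonelli_G _ _ _ _ _ lebesgue_measure (f \o cons_rV)) => //.
    exact: measurableT_comp mf measurable_cons_rV.
  by move=> p; exact: f0.
rewrite (h1 _ (fun y => \int[lebesgue_measure]_t f (cons_rV (t, y)))%E)//; last first.
  by move=> y; exact: integral_ge0.
by rewrite det1 normr1 invr1 mul1e ge0_integral_rV_fubini2.
Qed.

(** Gaussian elimination by induction on [n]: a matrix with nonzero pivot is a product of a lower
    and an upper block triangular one, and a zero pivot is first repaired by a row operation. *)
Lemma ge0_integral_rV_affine n (A : 'M[R]_n) : A \in unitmx -> affine_jacobian A.
Proof.
elim: n A => [|n IH] A uA.
  move=> b f mf f0; rewrite det_mx00 normr1 invr1 mul1e.
  by apply: eq_integral => y _; congr f; apply/rowP => -[].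
have pivot (M : 'M[R]_(1 + n)) : M \in unitmx -> M ord0 ord0 != 0 ->
    affine_jacobian (M : 'M[R]_n.+1).
  move=> uM; set a := M ord0 ord0 => a0.
  have uaE : ulsubmx M = a%:M.
    rewrite [LHS]mx11_scalar; congr (_%:M); rewrite !mxE.
    by congr (M _ _); exact/val_inj.
  pose c : 'cV[R]_n := a^-1 *: dlsubmx M.
  (* The Schur complement of the pivot, invertible because [M] is. *)
  pose S : 'M[R]_n := drsubmx M - c *m ursubmx M.
  have ME : M = (block_mx 1%:M 0 c 1%:M : 'M[R]_(1 + n)) *m block_mx a%:M (ursubmx M) 0 S.
    rewrite mulmx_block !mul1mx !mul0mx !addr0 mul_mx_scalar scalerA.
    by rewrite divff// scale1r /S addrC subrK -[LHS]submxK uaE.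
  have uS : S \in unitmx.
    move: uM; rewrite ME unitmx_mul => /andP[_].
    by rewrite !unitmxE det_ublock unitrM => /andP[].
  rewrite ME; apply: affine_jacobianM.
    by apply: affine_jacobian_lblock; apply: IH; exact: unitmx1.
  by apply: affine_jacobian_ublock => //; exact: IH.
have [A00|] := eqVneq (A ord0 ord0) 0; last exact: pivot.
have [i Ai0] : exists i : 'I_n, A (lift ord0 i) ord0 != 0.
  apply: contrapT => /forallNP Ai0.
  move: uA; rewrite unitmxE (expand_det_col _ ord0) big1 ?unitr0// => j _.
  case: (unliftP ord0 j) => [i ->|->]; last by rewrite A00 mul0r.
  by have /negP/negPn/eqP -> := Ai0 i; rewrite mul0r.
(* Left multiplication by [U 1] adds row [lift ord0 i] to the first row, which makes the pivot
   nonzero; [U (-1)] undoes it. *)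
pose U s : 'M[R]_(1 + n) := block_mx 1%:M (s *: delta_mx ord0 i) 0 1%:M.
have UM : U (-1) *m U 1 = 1%:M.
  rewrite mulmx_block !mul1mx !mulmx0 !mul0mx !addr0 mulmx1.
  by rewrite -scalerDl subrr scale0r add0r -scalar_mx_block.
rewrite -[A](mul1mx (A : 'M[R]_(1 + n))) -UM -mulmxA.
apply: affine_jacobianM.
  apply: affine_jacobian_ublock; first exact: oner_neq0.
  by apply: IH; exact: unitmx1.
apply: pivot.
  by rewrite unitmx_mul uA andbT; have /mulmx1_unit[_ ->] := UM.
rewrite -[A in U 1 *m A](@submxK _ 1 n 1 n) mulmx_block scale1r !mul1mx.
rewrite (_ : ord0 = lshift n ord0 :> 'I_(1 + n)); last exact/val_inj.
rewrite block_mxEul !mxE (bigD1 i)//= big1 ?addr0; last first.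
  by move=> j ji; rewrite !mxE (negbTE ji) andbF mul0r.
rewrite !mxE !eqxx mul1r (_ : lshift n ord0 = ord0); last exact/val_inj.
by rewrite A00 add0r (_ : rshift 1 i = lift ord0 i) //; exact/val_inj.
Qed.

End integral_rV.

Lemma ge0_integral_rV_prod (R : realType) n (g : R -> R) (I : R) :
  measurable_fun setT g -> (forall t, 0 <= g t) ->
  (\int[lebesgue_measure]_t (g t)%:E = I%:E)%E ->
  (\int[lebesgue_rV R n]_y (\prod_i g (y ord0 i))%R%:E = (I ^+ n)%:E)%E.
Proof.
move=> mg g0 gI; elim: n => [|n IH].
  by under eq_integral do rewrite big_ord0; rewrite integral_dirac//= diracT mul1e.
have mprod m : measurable_fun setT
    (fun y : 'rV[R]_m => (\prod_i g (y ord0 i))%:E).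
  apply/measurable_EFinP; apply: measurable_prod => i _.
  exact: measurableT_comp mg (measurable_rV_coord i).
have prod0 m (y : 'rV[R]_m) : (0 <= (\prod_i g (y ord0 i))%:E)%E.
  by rewrite lee_fin; apply: prodr_ge0.
have I0 : 0 <= I by rewrite -lee_fin -gI; apply: integral_ge0 => t _; rewrite lee_fin.
rewrite ge0_integral_rV_fubini1//.
transitivity (\int[lebesgue_measure]_t ((g t)%:E * (I ^+ n)%:E))%E.
  apply: eq_integral => t _.
  rewrite -IH -ge0_integralZl ?lee_fin//; last exact: mprod.
  apply: eq_integral => y _; rewrite big_ord_recl cons_rV0 -EFinM; congr (_ * _)%:E.
  by apply: eq_bigr => i _; rewrite cons_rVS.
rewrite ge0_integralZr//; first by rewrite gI -EFinM exprS.
- exact/measurable_EFinP.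
- by move=> t _; rewrite lee_fin.
- by rewrite lee_fin exprn_ge0.
Qed.

Lemma integral_oneDsqrV (R : realType) :
  (\int[lebesgue_measure]_t ((1 + t ^+ 2)^-1)%R%:E = (pi : R)%:E)%E.
Proof.
have cg : continuous (fun t : R => (1 + t ^+ 2)^-1) := @continuous_oneDsqrV R.
rewrite (@ge0_symfun_integralT _ (fun t : R => (1 + t ^+ 2)^-1))//.
- rewrite -set_itvcy [X in (_ * X)%E](_ : _ = (pi / 2)%:E); last exact: integral0y_oneDsqr.
  rewrite -EFinM; congr EFin.
  by rewrite mulrC divfK// pnatr_eq0.
- by move=> t; rewrite invr_ge0 addr_ge0// sqr_ge0.
- by move=> t /=; rewrite sqrrN.
Qed.

(** * Peaked polynomials *)

Section peaked_polynomial.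
Context {R : realType}.

(** Chebyshev's recurrence $\cos(b+a)=2\cos a\cos b-\cos(b-a)$ with $a=2\phi$ and $2\cos
    2\phi=2-4\sin^2\phi$. It has two terms, so the induction carries two consecutive polynomials. *)
Lemma cos_double_poly j : exists2 c : {poly R}, (size c <= j.+1)%N &
  forall phi, c.[sin phi ^+ 2] = cos (phi *+ j.*2).
Proof.
suff [c [_ [sc _ Ec _]]] : exists c c' : {poly R},
    [/\ (size c <= j.+1)%N, (size c' <= j.+2)%N,
      forall phi, c.[sin phi ^+ 2] = cos (phi *+ j.*2) &
      forall phi, c'.[sin phi ^+ 2] = cos (phi *+ j.+1.*2)] by exists c.
have cos2 phi : cos (phi *+ 2) = 1 - 2 * sin phi ^+ 2 :> R.
  by rewrite cos_mulr2n cos2sin2; ring.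
elim: j => [|j [c [c' [sc sc' Ec Ec']]]].
  exists 1, (1 - 2 *: 'X); rewrite size_poly1; split => //.
  - rewrite (leq_trans (size_polyD _ _))// size_poly1 size_polyN geq_max/=.
    by rewrite (leq_trans (size_scale_leq _ _))// size_polyX.
  - by move=> phi; rewrite hornerC mulr0n cos0.
  - by move=> phi; rewrite (cos2 phi) hornerD hornerN hornerZ hornerC hornerX.
exists c', ((2%:P - 4 *: 'X) * c' - c); split => //.
  rewrite (leq_trans (size_polyD _ _))// size_polyN geq_max; apply/andP; split.
    rewrite (leq_trans (size_polyMleq _ _))//.
    have s2 : (size (2%:P - 4 *: 'X : {poly R})%R <= 2)%N.
      rewrite (leq_trans (size_polyD _ _))// size_polyN geq_max.
      rewrite (leq_trans (size_polyC_leq1 _))//=.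
      by rewrite (leq_trans (size_scale_leq _ _))// size_polyX.
    by rewrite -subn1 leq_subLR; exact: leq_add s2 sc'.
  by rewrite (leq_trans sc)// ltnW.
move=> phi; rewrite hornerD hornerN hornerM Ec Ec'.
have -> : phi *+ j.*2 = phi *+ j.+1.*2 - phi *+ 2.
  by rewrite doubleS -addn2 mulrnDr addrK.
have -> : phi *+ j.+2.*2 = phi *+ j.+1.*2 + phi *+ 2 by rewrite -mulrnDr addn2.
move: (cos2 phi); move: (phi *+ 2) (phi *+ j.+1.*2) => a b c2.
by rewrite cosB cosD c2 hornerD hornerN hornerZ hornerC hornerX; ring.
Qed.

(* The square of the Dirichlet kernel [sin ((2k+1) phi) / ((2k+1) sin phi)],
   as a polynomial in [sin phi ^+ 2]. *)
Lemma fejer_poly k : exists K : {poly R},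
  [/\ (size K <= k.*2.+1)%N, K.[0] = 1 & forall v, 0 <= v <= 1 ->
    0 <= K.[v] <= 1 /\ K.[v] * v * k.*2.+1%:R ^+ 2 <= 1].
Proof.
(* [w] is the Dirichlet kernel before normalization and squaring. *)
have [w [sw Ew w0 wle]] : exists w : {poly R}, [/\ (size w <= k.+1)%N,
    forall phi, w.[sin phi ^+ 2] * sin phi = sin (phi *+ k.*2.+1),
    w.[0] = k.*2.+1%:R & forall phi, `|w.[sin phi ^+ 2]| <= k.*2.+1%:R].
  elim: k => [|k [w [sw Ew w0 wle]]].
    exists 1; rewrite size_poly1; split => //.
    - by move=> phi; rewrite hornerC mul1r.
    - by rewrite hornerC.
    - by move=> phi; rewrite hornerC normr1.
  have [c sc Ec] := cos_double_poly k.+1.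
  (* By $\sin((2k+3)\phi)-\sin((2k+1)\phi)=2\cos((2k+2)\phi)\sin\phi$. *)
  exists (w + 2 *: c); split.
  - rewrite (leq_trans (size_polyD _ _))// geq_max (leq_trans sw)//=.
    exact: leq_trans (size_scale_leq _ _) sc.
  - move=> phi; rewrite hornerD hornerZ mulrDl Ew Ec.
    have -> : phi *+ k.*2.+1 = phi *+ k.+1.*2 - phi.
      by rewrite doubleS [in RHS]mulrS addrAC subrr add0r.
    have -> : phi *+ k.+1.*2.+1 = phi *+ k.+1.*2 + phi by rewrite mulrS addrC.
    by move: (phi *+ k.+1.*2) => a; rewrite sinB sinD; ring.
  - have := Ec 0; rewrite sin0 expr0n/= mul0rn cos0 => c0.
    by rewrite hornerD hornerZ w0 c0 mulr1 doubleS -natrD addn2.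
  - move=> phi; rewrite hornerD hornerZ Ec (le_trans (ler_normD _ _))//.
    rewrite (_ : k.+1.*2.+1%:R = k.*2.+1%:R + 2)//; last first.
      by rewrite doubleS -natrD addn2.
    by apply: lerD; rewrite // normrM ger0_norm// ler_piMr// cos_max.
have N0 : 0 < k.*2.+1%:R :> R by rewrite ltr0n.
exists ((k.*2.+1%:R ^+ 2)^-1 *: w ^+ 2); split.
- rewrite (leq_trans (size_scale_leq _ _))// expr2 (leq_trans (size_polyMleq _ _))//.
  by rewrite -subn1 leq_subLR; apply: leq_trans (leq_add sw sw) _; rewrite -addnn; lia.
- by rewrite hornerZ horner_exp w0 mulVf// expf_neq0// gt_eqF.
move=> v /andP[v0 v1].
have sv : Num.sqrt v \in `[(-1), 1].
  rewrite in_itv/= (le_trans _ (sqrtr_ge0 v)) ?lerN10//=.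
  by rewrite -sqrtr1 ler_wsqrtr.
set phi := asin (Num.sqrt v).
have sphi : sin phi ^+ 2 = v by rewrite asinK// sqr_sqrtr.
rewrite hornerZ horner_exp.
have wv : w.[v] ^+ 2 <= k.*2.+1%:R ^+ 2.
  by rewrite -real_normK ?num_real// lerXn2r ?nnegrE//; rewrite -sphi.
split.
  by rewrite mulr_ge0 ?invr_ge0 ?sqr_ge0//= ler_pdivrMl ?exprn_gt0// mulr1.
(* The normalization cancels, and what is left is $\sin^2((2k+1)\phi)\le 1$. *)
rewrite mulrC mulrA mulrA divff ?mul1r; last by rewrite expf_neq0// gt_eqF.
rewrite -[X in _ * X]sphi -exprMn -{1}sphi Ew.
by rewrite -real_normK ?num_real// expr_le1// sin_max.
Qed.

End peaked_polynomial.

(** Adding the mirror image of the peak at [s0] makes the function even in [s], hence a polynomial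
    in $s^2$ of half the degree. The mirror term obeys the same decay, since $|s+s_0|\ge|s-s_0|$ for
    nonnegative arguments; each term contributes 4 to the constant 8 because of the halved
    arguments. *)
Lemma peaked_poly_sqr (R : realType) k (s0 : R) : 0 <= s0 <= 1 -> exists p : {poly R},
  [/\ (size p <= k.*2.+1)%N, 1 <= p.[s0 ^+ 2] & forall s, 0 <= s <= 1 ->
    0 <= p.[s ^+ 2] <= 2 /\ p.[s ^+ 2] * (s - s0) ^+ 2 * k.*2.+1%:R ^+ 2 <= 8].
Proof.
move=> /andP[s00 s01]; have [K [sK K0 HK]] := @fejer_poly R k.
set N := k.*2.+1%:R ^+ 2 in HK *.
have N0 : 0 <= N by rewrite exprn_ge0.
pose q : {poly R} := (2^-1 *: ('X - s0%:P)) ^+ 2.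
have qE s : q.[s] = ((s - s0) / 2) ^+ 2.
  by rewrite horner_exp hornerZ hornerD hornerN hornerX hornerC mulrC.
pose G := K \Po q.
have GE s : 2 * (even_poly G).[s ^+ 2] =
    K.[((s - s0) / 2) ^+ 2] + K.[((s + s0) / 2) ^+ 2].
  have GE x : G.[x] = (even_poly G).[x ^+ 2] + (odd_poly G).[x ^+ 2] * x.
    rewrite -[in LHS](poly_even_odd G) hornerD hornerM hornerX.
    by rewrite (horner_comp (even_poly G)) (horner_comp (odd_poly G)) hornerXn.
  have -> : K.[((s + s0) / 2) ^+ 2] = G.[- s].
    by rewrite horner_comp qE; congr K.[_]; field.
  have -> : K.[((s - s0) / 2) ^+ 2] = G.[s] by rewrite horner_comp qE.
  by rewrite !GE sqrrN; ring.
exists (2 *: even_poly G); split.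
- rewrite (leq_trans (size_scale_leq _ _))// (leq_trans (size_even_poly _))//.
  have sq : (size q <= 3)%N.
    rewrite /q expr2 (leq_trans (size_polyMleq _ _))//.
    have s2 : (size (2^-1 *: ('X - s0%:P) : {poly R}) <= 2)%N.
      by rewrite (leq_trans (size_scale_leq _ _))// size_XsubC.
    by rewrite -subn1 leq_subLR; exact: (leq_add s2 s2).
  have := size_comp_poly_leq K q; rewrite -/G => sG.
  have : ((size K).-1 * (size q).-1 <= k.*2 * 2)%N by apply: leq_mul; lia.
  lia.
- rewrite hornerZ GE subrr mul0r expr0n/= K0 lerDl.
  have /HK[/andP[]//] : 0 <= ((s0 + s0) / 2) ^+ 2 <= 1.
  by rewrite sqr_ge0 expr_le1//; lra.
move=> s /andP[s0' s1]; rewrite hornerZ GE.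
have /HK[/andP[K1 K1'] K1N] : 0 <= ((s - s0) / 2) ^+ 2 <= 1.
  by rewrite sqr_ge0 -real_normK ?num_real// expr_le1// ler_norml; apply/andP; lra.
have /HK[/andP[K2 K2'] K2N] : 0 <= ((s + s0) / 2) ^+ 2 <= 1.
  by rewrite sqr_ge0 expr_le1//; lra.
split; first by rewrite addr_ge0//=; lra.
have ss : (s - s0) ^+ 2 <= (s + s0) ^+ 2.
  by rewrite -subr_ge0 (_ : _ - _ = 4 * (s * s0)) ?mulr_ge0//; ring.
have : K.[((s + s0) / 2) ^+ 2] * (s - s0) ^+ 2 * N <=
    K.[((s + s0) / 2) ^+ 2] * (s + s0) ^+ 2 * N.
  by rewrite ler_wpM2r// ler_wpM2l.
move: K1N K2N; rewrite !expr_div_n.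
set a := K.[_]; set b := K.[_]; nra.
Qed.

(** The substitution $t=C_0s^2$ reduces to the peaked polynomial in $s^2$. In the factorization
    $(t-t_0)^2=C_0^2(s-s_0)^2(s+s_0)^2$, the factor $(s+s_0)^2/s_0^2$ is bounded near the peak; away
    from it, the lower bound on [t0] lets a second power of the decay absorb its growth. *)
Lemma localized_poly (R : realType) (d : nat) (sg C0 : R) :
  (0 < d)%N -> 0 < sg -> 0 < C0 -> exists2 C : R, 0 < C &
  forall (n : nat) (t0 : R), (0 < n)%N -> sg * n%:R ^- 2 <= t0 <= C0 ->
  exists p : {poly R}, [/\ (d * (size p).-1 <= n)%N, 1 <= p.[t0] &
    forall t, 0 <= t <= C0 ->
      p.[t] ^+ 2 * (1 + n%:R ^+ 2 * (t - t0) ^+ 2 / t0) <= C].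
Proof.
move=> d0 sg0 C00; have d0R : 0 < d%:R :> R by rewrite ltr0n.
(* For the quantity [M] introduced below, $M\le 8$ and $P\le 2$, so 64 bounds $M^2$ and 128 bounds
   $8PM$; the 4 added to [C1] bounds $P^2$. *)
pose C1 : R := C0 * (4 * d%:R ^+ 2) * (8 * d%:R ^+ 2 * C0 / sg * 64 + 128).
have C10 : 0 <= C1.
  by rewrite /C1 !(mulr_ge0, addr_ge0, invr_ge0, exprn_ge0)// ltW.
exists (4 + C1); first by rewrite ltr_wpDr.
move=> n t0 n0 /andP[sgt0 t0C0]; have n0R : 0 < n%:R :> R by rewrite ltr0n.
have t00 : 0 < t0 by rewrite (lt_le_trans _ sgt0)// divr_gt0// exprn_gt0.
have s0P : Num.sqrt (t0 / C0) ^+ 2 = t0 / C0 by rewrite sqr_sqrtr// divr_ge0// ltW.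
have s0g : 0 < Num.sqrt (t0 / C0) by rewrite sqrtr_gt0 divr_gt0.
have s01 : 0 <= Num.sqrt (t0 / C0) <= 1.
  by rewrite sqrtr_ge0 -sqrtr1 ler_wsqrtr// ler_pdivrMr// mul1r.
(* The largest [k] for which [d] factors of degree $2k$ have total degree at most [n]; rounding
   still leaves $n\le 2d(2k+1)$. *)
pose k := (n %/ d.*2)%N.
have [p [sp p1 pP]] := @peaked_poly_sqr R k _ s01.
set s0 := Num.sqrt (t0 / C0) in s0P s0g s01 p1 pP.
exists (p \Po (C0^-1 *: 'X)).
have pE t : (p \Po (C0^-1 *: 'X)).[t] = p.[t / C0].
  by rewrite horner_comp hornerZ hornerX mulrC.
have dk : (d * k.*2 <= n)%N.
  by rewrite -doubleMr doubleMl mulnC; exact: leq_divM.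
split.
- rewrite size_comp_poly2; last by rewrite size_scale ?size_polyX// invr_neq0// gt_eqF.
  rewrite (leq_trans _ dk)// leq_mul2l; apply/orP; right.
  by move: sp; case: size.
- by rewrite pE -s0P.
move=> t /andP[t1 tC0]; rewrite pE.
have sP : Num.sqrt (t / C0) ^+ 2 = t / C0 by rewrite sqr_sqrtr// divr_ge0// ltW.
have s1 : 0 <= Num.sqrt (t / C0) <= 1.
  by rewrite sqrtr_ge0 -sqrtr1 ler_wsqrtr// ler_pdivrMr// mul1r.
have [] := pP _ s1; rewrite sP.
set s := Num.sqrt _ in sP s1 *; set P := p.[_]; set N : R := k.*2.+1%:R.
move=> /andP[P0 P2] PM.
have nN : n%:R ^+ 2 <= 4 * d%:R ^+ 2 * N ^+ 2.
  rewrite (_ : 4 * _ * _ = (2 * d%:R * N) ^+ 2); last by ring.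
  rewrite lerXn2r ?nnegrE ?mulr_ge0// -!natrM ler_nat.
  have := ltn_ceil n (_ : 0 < d.*2)%N; rewrite double_gt0 -/k => /(_ d0).
  move=> /ltnW/leq_trans; apply; rewrite mulnC -mul2n leq_mul//.
  by rewrite ltnS -addnn leq_addr.
have tE : t = C0 * s ^+ 2 by rewrite sP mulrC divfK// gt_eqF.
have t0E : t0 = C0 * s0 ^+ 2 by rewrite s0P mulrC divfK// gt_eqF.
set D := (s - s0) ^+ 2 in PM *.
have D0 : 0 <= D by exact: sqr_ge0.
have XE : n%:R ^+ 2 * (t - t0) ^+ 2 / t0 =
    C0 * n%:R ^+ 2 * D * ((s + s0) ^+ 2 / s0 ^+ 2).
  by rewrite tE t0E /D; field; rewrite !gt_eqF.
have s0V : (s0 ^+ 2)^-1 <= 4 * d%:R ^+ 2 * N ^+ 2 * C0 / sg.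
  rewrite (@le_trans _ _ (n%:R ^+ 2 * C0 / sg))//; last first.
    by rewrite ler_pM2r ?invr_gt0// ler_pM2r.
  rewrite -[X in X <= _]div1r ler_pdivrMr ?exprn_gt0// mulrAC ler_pdivlMr// mul1r.
  by move: sgt0; rewrite t0E ler_pdivrMr ?exprn_gt0//; lra.
(* From $s+s_0=(s-s_0)+2s_0$, which gives $(s+s_0)^2\le 2(s-s_0)^2+8s_0^2$. *)
have ssD : (s + s0) ^+ 2 / s0 ^+ 2 <= 2 * D * (4 * d%:R ^+ 2 * N ^+ 2 * C0 / sg) + 8.
  apply: (@le_trans _ _ ((2 * D + 8 * s0 ^+ 2) / s0 ^+ 2)).
    rewrite ler_pM2r ?invr_gt0 ?exprn_gt0// /D -subr_ge0.
    rewrite (_ : _ - _ = (s - 3 * s0) ^+ 2) ?sqr_ge0//; ring.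
  rewrite mulrDl mulfK ?expf_neq0 ?gt_eqF// lerD2r ler_wpM2l//.
  by rewrite mulr_ge0.
have XY : n%:R ^+ 2 * (t - t0) ^+ 2 / t0 <=
    C0 * (4 * d%:R ^+ 2 * N ^+ 2) * D * (2 * D * (4 * d%:R ^+ 2 * N ^+ 2 * C0 / sg) + 8).
  rewrite XE; apply: ler_pM => //.
  - by apply: mulr_ge0 => //; apply: mulr_ge0; [exact: ltW|exact: exprn_ge0].
  - by rewrite divr_ge0// sqr_ge0.
  - by rewrite ler_wpM2r// ler_wpM2l// ltW.
clearbody P N D; set M := P * D * N ^+ 2 in PM.
have M0 : 0 <= M by rewrite mulr_ge0 ?sqr_ge0// mulr_ge0.
rewrite mulrDr mulr1; apply: lerD.
  by move: P0 P2; clear; nra.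
apply: (le_trans (ler_wpM2l (sqr_ge0 P) XY)).
rewrite (_ : P ^+ 2 * _ = C0 * (4 * d%:R ^+ 2) *
    (8 * d%:R ^+ 2 * C0 / sg * M ^+ 2 + 8 * (P * M))); last first.
  by rewrite /M; field; rewrite gt_eqF.
rewrite /C1 ler_wpM2l//; first by apply: mulr_ge0; [exact: ltW|rewrite mulr_ge0// sqr_ge0].
apply: lerD; last by nra.
rewrite ler_wpM2l//; first by rewrite divr_ge0 ?mulr_ge0 ?sqr_ge0// ltW.
by nra.
Qed.

(** * The Christoffel function and affine coordinates *)

Lemma measurable_box_rV (R : realType) n (a b : 'rV[R]_n) :
  measurable [set x : 'rV[R]_n | forall i, a ord0 i <= x ord0 i <= b ord0 i].
Proof.
rewrite (_ : [set _ | _] = \bigcap_(i in [set: 'I_n])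
    (rV_coord i @^-1` (`[a ord0 i, b ord0 i]%classic : set R))).
  apply: fin_bigcap_measurable => // i _.
  by rewrite -[X in measurable X]setTI; exact: measurable_rV_coord.
apply/seteqP; split => x /= xab i; first by move=> _; rewrite /= in_itv/=; exact: xab.
by have := xab i Logic.I; rewrite /= in_itv.
Qed.

(** * Measurability of open and compact sets, finite volume of compact sets *)

Section closed_sets.
Context {R : realType} {n : nat}.

(** An open set is the union of the countably many rational boxes inside it; [F] replaces all other
    boxes by the empty set. *)
Lemma open_measurable_rV (U : set 'rV[R]_n) : open U -> measurable U.
Proof.
move=> oU.
pose box (q : 'rV[rat]_n * 'rV[rat]_n) : set 'rV[R]_n :=
  [set x | forall i, x ord0 i \in `]ratr (q.1 ord0 i), ratr (q.2 ord0 i)[].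
have mbox q : measurable (box q).
  rewrite (_ : box q = \bigcap_(i in [set: 'I_n])
      (rV_coord i @^-1` (`]ratr (q.1 ord0 i), ratr (q.2 ord0 i)[%classic : set R))).
    apply: fin_bigcap_measurable => // i _.
    by rewrite -[X in measurable X]setTI; exact: measurable_rV_coord.
  by apply/seteqP; split => x /= xq i; [move=> _|]; exact: xq.
pose F q := if pselect (box q `<=` U) then box q else set0.
rewrite (_ : U = \bigcup_q F q).
  apply: countable_bigcupT_measurable; first exact: countableP.
  by move=> q; rewrite /F; case: pselect => ?; [exact: mbox|exact: measurable0].
apply/seteqP; split => [x Ux|x [q _]]; last by rewrite /F; case: pselect => // h /h.
have /nbhs_ballP[e /= e0 eU] : nbhs x U by exact: open_nbhs_nbhs.
have /choice[a aP] i : exists r : rat, ratr r \in `]x ord0 i - e, x ord0 i[.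
  by apply: rat_in_itvoo; rewrite ltrBlDr ltrDl; exact: e0.
have /choice[b bP] i : exists r : rat, ratr r \in `]x ord0 i, x ord0 i + e[.
  by apply: rat_in_itvoo; rewrite ltrDl; exact: e0.
exists (\row_i a i, \row_i b i) => //; rewrite /F; case: pselect => [_ /= i|[]].
  by move: (aP i) (bP i); rewrite !in_itv/= !mxE => /andP[_ ->] /andP[->].
move=> y yab; apply: eU; split => // i j; rewrite ord1 {i}.
move: (yab j) (aP j) (bP j); rewrite !in_itv/= !mxE.
move=> /andP[ay yb] /andP[xa ax] /andP[xb bx].
by rewrite /ball/= ltr_distlC; apply/andP; split; lra.
Qed.

Lemma closed_measurable_rV (D : set 'rV[R]_n) : closed D -> measurable D.
Proof.
by rewrite -openC -[X in measurable X]setCK => /open_measurable_rV; exact: measurableC.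
Qed.

Lemma compact_measurable_rV (D : set 'rV[R]_n) : compact D -> measurable D.
Proof. by move=> /(compact_closed (@norm_hausdorff _ _)); exact: closed_measurable_rV. Qed.

Lemma compact_coord_bounded (D : set 'rV[R]_n) : compact D ->
  exists2 M : R, 0 < M & forall y, D y -> forall i, `|y ord0 i| <= M.
Proof.
move=> /compact_bounded/pinfty_ex_gt0[M M0 DM]; exists M => // y Dy i.
apply: le_trans (DM y Dy).
by rewrite [leRHS]mx_normrE; exact: (le_bigmax _ _ (ord0, i)).
Qed.

Lemma compact_lebesgue_rV_fin (D : set 'rV[R]_n) : compact D ->
  (lebesgue_rV R n D < +oo)%E.
Proof.
move=> cD; have [M M0 DM] := compact_coord_bounded cD.
have Mi i : (const_mx (- M) : 'rV[R]_n) ord0 i <= (const_mx M : 'rV[R]_n) ord0 i.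
  by rewrite !mxE ge0_cp// ltW.
apply: le_lt_trans (_ : (\prod_(i < n) (M - - M))%:E < _)%E; last exact: ltry.
have <- : \prod_(i < n) ((const_mx M : 'rV[R]_n) ord0 i - (const_mx (- M) : 'rV[R]_n) ord0 i)
    = \prod_(i < n) (M - - M) by apply: eq_bigr => i _; rewrite !mxE.
rewrite -(lebesgue_rV_box Mi); set box := (X in (_ <= lebesgue_rV _ _ X)%E).
have mbox : measurable box := measurable_box_rV _ _.
apply: le_measure; rewrite ?inE//; first exact: compact_measurable_rV.
by move=> y /DM yM i; rewrite !mxE -ler_norml.
Qed.

End closed_sets.

(** Expanding $\sum_i(Ba_i-Cb_i)^2\ge 0$ gives $B(AB-C^2)\ge 0$; if $B=0$, every $b_i$ vanishes. *)
Lemma cauchy_schwarz_sum (R : realFieldType) (I : finType) (a b : I -> R) :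
  (\sum_i a i * b i) ^+ 2 <= (\sum_i a i ^+ 2) * (\sum_i b i ^+ 2).
Proof.
set A := \sum_i a i ^+ 2; set B := \sum_i b i ^+ 2; set C := \sum_i _.
have B0 : 0 <= B by apply: sumr_ge0 => i _; exact: sqr_ge0.
have : 0 <= \sum_i (B * a i - C * b i) ^+ 2 by apply: sumr_ge0 => i _; exact: sqr_ge0.
have -> : \sum_i (B * a i - C * b i) ^+ 2 = B * (A * B - C ^+ 2).
  transitivity (B ^+ 2 * A - 2 * B * C * C + C ^+ 2 * B); last by ring.
  rewrite [in X in X - _]mulr_sumr [X in _ - X]mulr_sumr [X in _ + X]mulr_sumr.
  rewrite -sumrB -big_split/=; apply: eq_bigr => i _; ring.
move: B0; rewrite le_eqVlt => /predU1P[B0 _|B0]; last by rewrite pmulr_rge0// subr_ge0.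
suff -> : C = 0 by rewrite -B0 mulr0 expr0n.
apply: big1 => i _; suff /eqP -> : b i == 0 by rewrite mulr0.
rewrite -sqrf_eq0; apply/eqP.
by apply: (psumr_eq0P (P := xpredT) (F := fun i => b i ^+ 2)) => // j _; exact: sqr_ge0.
Qed.

(** * Polynomial functions, their inner product and the extremal property *)

Section polynomials.
Context {R : realType} {d : nat}.
Implicit Types (p q : mpoly.mpoly d R) (D : set 'rV[R]_d).

Lemma peval_comb (a : R) p q y : peval (a *: p + q) y = a * peval p y + peval q y.
Proof. by rewrite /peval mpoly.mevalD mpoly.mevalZ. Qed.

Lemma measurable_peval p D : measurable_fun D (peval p).
Proof.
apply: measurable_funTS; rewrite /peval.
under eq_fun do rewrite mpoly.mevalE.
apply: measurable_sum => m; apply: measurable_funM => //.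
apply: measurable_prod => i _; apply: measurable_funX; exact: measurable_rV_coord.
Qed.

Lemma peval_bounded D p : compact D ->
  exists M : R, forall y, D y -> `|peval p y| <= M.
Proof.
move=> /compact_coord_bounded[M M0 DM].
exists (\sum_(m <- mpoly.msupp p)
  `|mpoly.mcoeff m p| * \prod_i M ^+ mpoly.fun_of_multinom m i).
move=> y Dy; rewrite /peval mpoly.mevalE (le_trans (ler_norm_sum _ _ _))//.
apply: ler_sum => m _; rewrite normrM ler_wpM2l// normr_prod.
apply: ler_prod => i _; rewrite normr_ge0 normrX lerXn2r ?nnegrE ?(ltW M0)//.
exact: DM.
Qed.

Lemma integrable_pevalM D p q : compact D ->
  (lebesgue_rV R d).-integrable D (EFin \o (fun y => peval p y * peval q y)).
Proof.
move=> cD; apply: measurable_bounded_integrable.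
- exact: compact_measurable_rV.
- exact: compact_lebesgue_rV_fin.
- by apply: measurable_funM; exact: measurable_peval.
have [[M Mp] [N Nq]] := (peval_bounded p cD, peval_bounded q cD).
exists (M * N); split; rewrite ?num_real// => r Mr y Dy /=.
apply: le_trans (ltW Mr).
by rewrite normrM; apply: ler_pM => //; [exact: Mp|exact: Nq].
Qed.

Lemma L2dotC D p q : L2dot D p q = L2dot D q p.
Proof. by apply: eq_Rintegral => y _; rewrite mulrC. Qed.

Lemma L2dot_comb D (a : R) p q r : compact D ->
  L2dot D (a *: p + q) r = a * L2dot D p r + L2dot D q r.
Proof.
move=> cD; have mD := compact_measurable_rV cD.
have ipr := integrable_pevalM p r cD.
have iqr := integrable_pevalM q r cD.
have iZ : (lebesgue_rV R d).-integrable D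
    (EFin \o (fun y => a * (peval p y * peval r y))) := integrableZl mD a ipr.
rewrite -RintegralZl// -RintegralD//.
by apply: eq_Rintegral => y _; rewrite peval_comb mulrDl mulrA.
Qed.

Lemma L2dot_suml D N (a : 'I_N -> R) (phi : 'I_N -> mpoly.mpoly d R) r : compact D ->
  L2dot D (\sum_k a k *: phi k) r = \sum_k a k * L2dot D (phi k) r.
Proof.
move=> cD; elim/big_rec2: _ => [|k s p _ <-]; last exact: L2dot_comb.
(* The empty sum: linearity at $0=1\cdot 0+0$ reads $z=z+z$, so the product with the zero polynomial
   is 0. *)
have := L2dot_comb 1 0 0 r cD; rewrite scale1r addr0 mul1r => /eqP.
by rewrite addrC -subr_eq subrr eq_sym => /eqP.
Qed.

Lemma peval_sum N (a : 'I_N -> R) (phi : 'I_N -> mpoly.mpoly d R) y :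
  peval (\sum_k a k *: phi k) y = \sum_k a k * peval (phi k) y.
Proof.
elim/big_rec2: _ => [|k s p _ <-]; last exact: peval_comb.
by rewrite /peval mpoly.meval0.
Qed.

(** In the orthonormal basis, $\int_D f^2=\sum_k a_k^2$, and Cauchy-Schwarz gives $f(x)^2\le\sum_k
    a_k^2\sum_k\varphi_k(x)^2$. Any test polynomial thus bounds the Christoffel function from
    above. *)
Lemma christoffel_le_L2dot D n N (phi : 'I_N -> mpoly.mpoly d R) f x :
  compact D -> orthonormal_basis D n phi -> polys_le n f -> 1 <= peval f x ->
  christoffel phi x <= L2dot D f f.
Proof.
move=> cD [_ orth span] fn f1; have [a fE] := span f fn.
have ffE : L2dot D f f = \sum_k a k ^+ 2.
  rewrite {1}fE L2dot_suml//; apply: eq_bigr => k _.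
  rewrite L2dotC fE L2dot_suml// (bigD1 k)//= orth eqxx mulr1 big1 ?addr0 ?expr2//.
  by move=> j jk; rewrite orth (negbTE jk) mulr0.
have : 1 <= (\sum_k a k ^+ 2) * \sum_k peval (phi k) x ^+ 2.
  apply: le_trans (cauchy_schwarz_sum a (fun k => peval (phi k) x)).
  by rewrite -peval_sum -fE expr_ge1// (le_trans _ f1).
rewrite ffE /christoffel; set A := \sum_k _; set B := \sum_k _ => AB.
have B0 : 0 <= B by apply: sumr_ge0 => i _; exact: sqr_ge0.
have {}B0 : 0 < B.
  by rewrite lt_neqAle B0 andbT; apply: contraTneq AB => <-; rewrite mulr0 ler10.
by rewrite -[leLHS]mul1r ler_pdivrMr.
Qed.

End polynomials.

(** * Total degree of polynomials built from affine functions *)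

Section polynomial_degree.
Context {R : realType} {d : nat}.
Implicit Types (p q : mpoly.mpoly d R).

Lemma polys_le0C (n : nat) (c : R) : polys_le n (mpoly.mpolyC d c).
Proof. by rewrite /polys_le/= mpoly.msizeC; case: (c != 0). Qed.

Lemma polys_leD n p q : polys_le n p -> polys_le n q -> polys_le n (p + q).
Proof.
move=> pn qn; rewrite /polys_le/= (leq_trans (mpoly.msizeD_le _ _))// geq_max.
by apply/andP; split.
Qed.

Lemma polys_leZ n (c : R) p : polys_le n p -> polys_le n (c *: p).
Proof. by move=> pn; rewrite /polys_le/= (leq_trans (mpoly.msizeZ_le _ _)). Qed.

Lemma polys_leM m n p q : polys_le m p -> polys_le n q -> polys_le (m + n) (p * q).
Proof.
rewrite /polys_le/= => pm qn.
have [->|p0] := eqVneq p 0; first by rewrite mul0r mpoly.msize0.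
have [->|q0] := eqVneq q 0; first by rewrite mulr0 mpoly.msize0.
rewrite mpoly.msizeM// -subn1 leq_subLR (leq_trans (leq_add pm qn))//.
by rewrite addSn addnS.
Qed.

Lemma polys_le_sum n (I : Type) (r : seq I) (F : I -> mpoly.mpoly d R) :
  (forall i, polys_le n (F i)) -> polys_le n (\sum_(i <- r) F i).
Proof.
move=> Fn; elim/big_ind: _ => //; last by move=> p q; exact: polys_leD.
by rewrite /polys_le/= mpoly.msize0.
Qed.

Lemma polys_leX n k p : polys_le n p -> polys_le (k * n) (p ^+ k).
Proof.
move=> pn; elim: k => [|k IH]; first by rewrite expr0 mul0n; exact: (polys_le0C 0 1).
by rewrite exprS mulSn; exact: polys_leM.
Qed.

Lemma polys_le_prod n (I : Type) (r : seq I) (F : I -> mpoly.mpoly d R) :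
  (forall i, polys_le n (F i)) -> polys_le (size r * n) (\prod_(i <- r) F i).
Proof.
move=> Fn; elim: r => [|i r IH]; first by rewrite big_nil mul0n; exact: (polys_le0C 0 1).
by rewrite big_cons mulSn; exact: polys_leM.
Qed.

Lemma polys_le_widen m n p : (m <= n)%N -> polys_le m p -> polys_le n p.
Proof. by move=> mn pm; exact: leq_trans pm _. Qed.

Definition mpoly_of_affine (a : 'cV[R]_d) (c : R) : mpoly.mpoly d R :=
  \sum_j a j ord0 *: mpoly.mpolyX R (mpoly.mnm1 j) + mpoly.mpolyC d c.

Lemma peval_affine a c y : peval (mpoly_of_affine a c) y = (y *m a) ord0 ord0 + c.
Proof.
rewrite /peval mpoly.mevalD mpoly.mevalC; congr (_ + _).
by rewrite -/(peval _ _) peval_sum mxE; apply: eq_bigr => j _;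
  rewrite /peval mpoly.mevalXU mulrC.
Qed.

Lemma polys_le_affine a c : polys_le 1 (mpoly_of_affine a c).
Proof.
apply: polys_leD; last exact: polys_le0C.
apply: polys_le_sum => j; apply: polys_leZ.
by rewrite /polys_le/= mpoly.msizeX mpoly.mdeg1.
Qed.

Lemma poly_affine_mpoly (p : {poly R}) (a : 'cV[R]_d) c :
  exists2 f : mpoly.mpoly d R, polys_le (size p).-1 f &
    forall y, peval f y = p.[(y *m a) ord0 ord0 + c].
Proof.
pose q := mpoly_of_affine a c.
exists (\sum_(i < size p) p`_i *: q ^+ i) => [|y].
  apply: polys_le_sum => i; apply: polys_leZ.
  apply: (@polys_le_widen (i * 1)).
    by rewrite muln1 -ltnS (leq_trans (ltn_ord i))// leqSpred.
  exact: polys_leX (polys_le_affine a c).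
rewrite peval_sum horner_coef; apply: eq_bigr => i _.
by rewrite -peval_affine -/q /peval rmorphXn.
Qed.

End polynomial_degree.

(** The substitution by [A] followed by division of coordinate [i] by [s i] separates the variables;
    each factor then integrates to $\pi$. *)
Lemma ge0_integral_localized (R : realType) n (A : 'M[R]_n) (c : 'rV[R]_n) (s : 'I_n -> R) :
  A \in unitmx -> (forall i, 0 < s i) ->
  (\int[lebesgue_rV R n]_y
     (\prod_i (1 + ((y *m A + c) ord0 i / s i) ^+ 2)^-1)%R%:E =
   (pi ^+ n * (\prod_i s i) / `|\det A|)%:E)%E.
Proof.
move=> uA s0.
pose h (t : R) := (1 + t ^+ 2)^-1.
have h0 t : 0 <= h t by rewrite invr_ge0 addr_ge0// sqr_ge0.
have mh : measurable_fun setT h.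
  by apply: continuous_measurable_fun; exact: (@continuous_oneDsqrV R).
pose D : 'M[R]_n := diag_mx (\row_i (s i)^-1).
have detD : \det D = (\prod_i s i)^-1.
  by rewrite det_diag -prodfV; apply: eq_bigr => i _; rewrite mxE.
have s_gt0 : 0 < \prod_i s i by apply: prodr_gt0.
have uD : A *m D \in unitmx.
  by rewrite unitmx_mul uA unitmxE detD unitfE invr_neq0// gt_eqF.
transitivity (\int[lebesgue_rV R n]_y
    (\prod_i h ((y *m (A *m D) + c *m D) ord0 i))%R%:E)%E.
  apply: eq_integral => y _; congr EFin; apply: eq_bigr => i _.
  rewrite (_ : (y *m (A *m D) + _) ord0 i = (y *m A + c) ord0 i / s i)//.
  by rewrite mulmxA -mulmxDl mul_mx_diag mxE [X in _ * X]mxE.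
rewrite (ge0_integral_rV_affine uD _ (f := fun z => (\prod_i h (z ord0 i))%:E)); last 2 first.
- apply/measurable_EFinP; apply: measurable_prod => i _.
  exact: measurableT_comp mh (measurable_rV_coord i).
- by move=> z; rewrite lee_fin; apply: prodr_ge0.
rewrite (ge0_integral_rV_prod _ mh h0 (integral_oneDsqrV R)) -EFinM; congr EFin.
rewrite det_mulmx detD normrM normfV (gtr0_norm s_gt0) invfM invrK.
by rewrite mulrC mulrA mulrAC.
Qed.

(** The test polynomial is the product over [j] of polynomials of degree at most [n %/ d], peaked at
    [b ord0 j] in the [j]-th affine coordinate. Its square is dominated by a product of functions
    $(1+t^2)^{-1}$, which gives [C1] and $\pi$ once per coordinate. *)
Lemma christoffel_le_affine (R : realType) (d : nat) (sg C0 : R) :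
  (0 < d)%N -> 0 < sg -> 0 < C0 -> exists2 C : R, 0 < C &
  forall (D : set 'rV[R]_d) (x : 'rV[R]_d) (n N : nat)
      (phi : 'I_N -> mpoly.mpoly d R) (A : 'M[R]_d) (b : 'rV[R]_d),
    compact D -> (0 < n)%N -> orthonormal_basis D n phi -> A \in unitmx ->
    (forall j, sg * n%:R ^- 2 <= b ord0 j <= C0) ->
    (forall y, D y -> forall j, 0 <= ((y - x) *m A + b) ord0 j <= C0) ->
    christoffel phi x <= C * n%:R ^- d * (\prod_j Num.sqrt (b ord0 j)) / `|\det A|.
Proof.
move=> d0 sg0 C00; have [C1 C10 HC] := localized_poly d0 sg0 C00.
exists ((C1 * pi) ^+ d); first by rewrite exprn_gt0// mulr_gt0// pi_gt0.
move=> D x n N phi A b cD n0 orth uA bC DC.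
have n0R : 0 < n%:R :> R by rewrite ltr0n.
have b0 j : 0 < b ord0 j.
  have /andP[+ _] := bC j; apply: lt_le_trans.
  by rewrite divr_gt0// exprn_gt0.
have /choice[p pP] j := HC n (b ord0 j) n0 (bC j).
pose l y := (y - x) *m A + b.
have /choice[f fP] j : exists f : mpoly.mpoly d R,
    polys_le (n %/ d) f /\ forall y, peval f y = (p j).[l y ord0 j].
  have [f fdeg fE] := poly_affine_mpoly (p j) (col j A) (b ord0 j - (x *m A) ord0 j).
  exists f; split.
    by apply: polys_le_widen fdeg; rewrite leq_divRL// mulnC; have [] := pP j.
  move=> y; rewrite fE; congr _.[_].
  have -> : (y *m col j A) ord0 ord0 = (y *m A) ord0 j.
    by rewrite !mxE; apply: eq_bigr => k _; rewrite mxE.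
  rewrite /l mulmxBl 2![in RHS]mxE [X in _ + X + _]mxE; ring.
pose F := \prod_j f j.
have FE y : peval F y = \prod_j (p j).[l y ord0 j].
  rewrite /F /peval rmorph_prod/=; apply: eq_bigr => j _.
  by have [_] := fP j; apply.
have Fdeg : polys_le n F.
  apply: (@polys_le_widen _ _ (size (index_enum 'I_d) * (n %/ d))).
    rewrite (_ : size _ = d); last by rewrite -[RHS]card_ord cardT enumT.
    by rewrite mulnC; exact: leq_divM.
  by apply: polys_le_prod => j; have [] := fP j.
have Fx : 1 <= peval F x.
  rewrite FE /l subrr mul0mx add0r; apply: (big_ind (fun r => 1 <= r)) => //.
    by move=> r s r1 s1; rewrite -[1]mulr1 ler_pM.
  by move=> j _; have [] := pP j.
apply: le_trans (christoffel_le_L2dot cD orth Fdeg Fx) _.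
have iF := integrable_pevalM F F cD.
have mD := compact_measurable_rV cD.
rewrite -lee_fin /L2dot fineK; last exact: integrable_fin_num iF.
(* The width of the [j]-th peak: $n^2(t-b_j)^2/b_j=((t-b_j)/s_j)^2$. The widths multiply to the
   factor $n^{-d}\prod_j\sqrt{b_j}$. *)
pose s j := Num.sqrt (b ord0 j) / n%:R.
have s0 j : 0 < s j by rewrite divr_gt0// sqrtr_gt0.
pose g y := \prod_j (1 + ((y *m A - x *m A) ord0 j / s j) ^+ 2)^-1.
have g0 y : 0 <= g y.
  by apply: prodr_ge0 => j _; rewrite invr_ge0 addr_ge0// sqr_ge0.
have mg : measurable_fun setT g.
  apply: measurable_prod => j _.
  apply: (measurableT_comp (f := fun t : R => (1 + (t / s j) ^+ 2)^-1)).
    apply: continuous_measurable_fun.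
    rewrite -/((fun t : R => (1 + t ^+ 2)^-1) \o (fun t : R => t / s j)) => t.
    by apply: continuous_comp; [exact: mulrr_continuous|exact: (@continuous_oneDsqrV R)].
  apply: (measurableT_comp (measurable_rV_coord j)).
  exact: measurable_affine_rV.
have FFg y : D y -> peval F y * peval F y <= C1 ^+ d * g y.
  move=> Dy; rewrite FE -big_split/= -[X in C1 ^+ X](card_ord d) -prodr_const -big_split/=.
  apply: ler_prod => j _; rewrite -expr2 sqr_ge0/= ler_pdivlMr; last first.
    by rewrite ltr_pwDl// sqr_ge0.
  have [_ _ /(_ _ (DC y Dy j))] := pP j.
  rewrite -/(l y) (_ : n%:R ^+ 2 * _ / _ = ((y *m A - x *m A) ord0 j / s j) ^+ 2)//.
  rewrite (_ : l y ord0 j - _ = (y *m A - x *m A) ord0 j); last first.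
    by rewrite /l mulmxBl [in LHS]mxE addrK.
  rewrite -[X in _ / X](sqr_sqrtr (ltW (b0 j))) /s; field.
  by rewrite !gt_eqF// sqrtr_gt0.
have Egm E : measurable_fun E (EFin \o g) by apply: measurable_funTS; exact/measurable_EFinP.
have Eg0 y : (0 <= (g y)%:E)%E by rewrite lee_fin.
have C1d : 0 <= C1 ^+ d by rewrite exprn_ge0// ltW.
apply: (@le_trans _ _ (\int[lebesgue_rV R d]_(y in D) ((C1 ^+ d)%:E * (g y)%:E))%E).
  apply: ge0_le_integral => //.
  - by move=> y _; rewrite lee_fin -expr2 sqr_ge0.
  - exact: measurable_int iF.
  - exact: measurable_funeM.
rewrite ge0_integralZl ?lee_fin//.
apply: (@le_trans _ _ ((C1 ^+ d)%:E * \int[lebesgue_rV R d]_y (g y)%:E)%E).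
  apply: lee_wpmul2l; first by rewrite lee_fin.
  exact: ge0_subset_integral.
rewrite /g (ge0_integral_localized _ uA s0) -EFinM lee_fin.
rewrite big_split/= prodr_const card_ord exprVn exprMn.
by rewrite le_eqVlt; apply/orP; left; apply/eqP; ring.
Qed.

(** * Volumes of convex sections *)

Lemma lebesgue_rV_affine_preimage (R : realType) n (A : 'M[R]_n) (b : 'rV[R]_n)
    (E : set 'rV[R]_n) : A \in unitmx -> measurable E ->
  lebesgue_rV R n [set y | E (y *m A + b)] = ((`|\det A|^-1)%:E * lebesgue_rV R n E)%E.
Proof.
move=> uA mE.
have mpre : measurable [set y | E (y *m A + b)].
  by rewrite -[X in measurable X]setTI; exact: (measurable_affine_rV A b).
rewrite -[in LHS](setIT [set y | _]) -[in RHS](setIT E) -!integral_indic//.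
rewrite -(ge0_integral_rV_affine uA b) //; last exact/measurable_EFinP.
Qed.

(** The parallelepiped is the preimage of the cube $[0,h]^k$ under [invmx v]. *)
Lemma parallelepiped_volume_le (R : realType) k (v : 'M[R]_k) (K : set 'rV[R]_k) (h : R) :
  v \in unitmx -> measurable K -> 0 <= h ->
  (forall a : 'rV[R]_k, (forall i, 0 <= a ord0 i <= h) -> K (a *m v)) ->
  ((`|\det v| * h ^+ k)%:E <= lebesgue_rV R k K)%E.
Proof.
move=> uv mK h0 vK.
pose cube := [set a : 'rV[R]_k |
  forall i, (0 : 'rV[R]_k) ord0 i <= a ord0 i <= (const_mx h : 'rV[R]_k) ord0 i].
have mcube : measurable cube := measurable_box_rV _ _.
have cubeE : lebesgue_rV R k cube = (h ^+ k)%:E.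
  rewrite lebesgue_rV_box; last by move=> i; rewrite !mxE.
  congr EFin; under eq_bigr do rewrite !mxE subr0.
  by rewrite prodr_const card_ord.
have uiv : invmx v \in unitmx by rewrite unitmx_inv.
have := lebesgue_rV_affine_preimage 0 uiv mcube.
rewrite cubeE det_inv normfV invrK -EFinM => <-.
apply: le_measure; rewrite ?inE//.
  by rewrite -[X in measurable X]setTI; exact: (measurable_affine_rV (invmx v) 0).
move=> z /=; rewrite addr0 => zc; rewrite -(mulmxKV uv z); apply: vK => i.
by have := zc i; rewrite !mxE.
Qed.

(** A crude estimate from the Leibniz formula, used to know that a supremum of determinants is
    finite. *)
Lemma norm_det_le (R : realFieldType) k (v : 'M[R]_k) (M : R) :
  (forall i j, `|v i j| <= M) -> `|\det v| <= k`!%:R * M ^+ k.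
Proof.
move=> vM; rewrite /determinant (le_trans (ler_norm_sum _ _ _))//.
apply: (@le_trans _ _ (\sum_(s : 'S_k) M ^+ k)); last first.
  by rewrite sumr_const card_Sn mulr_natl.
apply: ler_sum => s _; rewrite normrM normrX normrN1 expr1n mul1r normr_prod.
rewrite -[X in M ^+ X](card_ord k) -prodr_const.
by apply: ler_prod => i _; rewrite normr_ge0 vM.
Qed.

(** Cramer's rule: the cofactors along row [j] do not see that row, and [invmx v] is the adjugate
    over the determinant. *)
Lemma mulmx_invmx_det_row (R : fieldType) k (v : 'M[R]_k) (z : 'rV[R]_k) j :
  v \in unitmx ->
  \det (\matrix_(i, l) (if i == j then z ord0 l else v i l)) =
  (z *m invmx v) ord0 j * \det v.
Proof.
move=> uv; set v' := \matrix_(_, _) _.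
have dv : \det v != 0 by rewrite -unitfE -unitmxE.
rewrite /invmx uv -scalemxAr mxE mulrAC mulVf// mul1r (expand_det_row _ j) mxE.
apply: eq_bigr => l _; rewrite !mxE eqxx; congr (_ * (_ * \det _)).
by apply/matrixP => a b; rewrite !mxE eq_sym (negbTE (neq_lift _ _)).
Qed.

(* The rows of [v] nearly maximize [|det|] among the matrices with rows in [K];
   by Cramer's rule the coordinates of the points of [K] in this basis are bounded. *)
Lemma near_auerbach (R : realType) k (K : set 'rV[R]_k) (M e : R) :
  (forall z, K z -> forall i, `|z ord0 i| <= M) -> 0 < e ->
  (forall i, K (e *: delta_mx ord0 i)) ->
  exists v : 'M[R]_k, [/\ v \in unitmx, forall i, K (row i v) &
    forall z, K z -> forall j, `|(z *m invmx v) ord0 j| <= 2].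
Proof.
move=> KM e0 Ke.
pose E := [set `|\det v| | v in [set v : 'M[R]_k | forall i, K (row i v)]].
have Eub : ubound E (k`!%:R * M ^+ k).
  move=> _ [v vK <-]; apply: norm_det_le => i j.
  by have := KM _ (vK i) j; rewrite mxE.
(* This admissible matrix makes the supremum positive. *)
have Ee : E `|\det (e%:M : 'M[R]_k)|.
  exists e%:M => // i; rewrite (_ : row i _ = e *: delta_mx ord0 i)//.
  by apply/rowP => j; rewrite !mxE eqxx mulr_natr eq_sym.
have supE : has_sup E.
  by split; [exists `|\det (e%:M : 'M[R]_k)| | exists (k`!%:R * M ^+ k)].
have S0 : 0 < sup E.
  apply: lt_le_trans (sup_upper_bound supE Ee).
  by rewrite normr_gt0 det_scalar expf_neq0// gt_eqF.
(* A determinant above half the supremum suffices: replacing a row by [z] can at most double it,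
   whence the bound 2. *)
have [_ [v vK <-] vS] := sup_adherent (divr_gt0 S0 (ltr0Sn R 1)) supE.
have dv0 : 0 < `|\det v| by apply: lt_trans vS; lra.
have uv : v \in unitmx by rewrite unitmxE unitfE -normr_gt0.
exists v; split => // z Kz j.
pose v' := \matrix_(i, l) (if i == j then z ord0 l else v i l).
have Ev' : E `|\det v'|.
  exists v' => // i; have [ij|ij] := eqVneq i j.
    rewrite (_ : row i v' = z)//; apply/rowP => l; by rewrite !mxE ij eqxx.
  rewrite (_ : row i v' = row i v)//; apply/rowP => l; by rewrite !mxE (negbTE ij).
have := sup_upper_bound supE Ev'.
rewrite mulmx_invmx_det_row// normrM => /le_lt_trans.
have vS2 : sup E < 2 * `|\det v| by move: vS; lra.
by move=> /(_ _ vS2); rewrite ltr_pM2r// => /ltW.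
Qed.

(** * Slices of a convex body *)

Section euclidean_geometry.
Context {R : realType} {d : nat}.
Implicit Types (x y u p : 'rV[R]_d) (D : set 'rV[R]_d).

Lemma dotvE x y : dotv x y = \sum_i x ord0 i * y ord0 i.
Proof. by rewrite /dotv mxE; apply: eq_bigr => i _; rewrite mxE. Qed.

Lemma dotvBl x y u : dotv (x - y) u = dotv x u - dotv y u.
Proof. by rewrite /dotv mulmxBl !mxE. Qed.

Lemma dotvZl (a : R) y u : dotv (a *: y) u = a * dotv y u.
Proof. by rewrite /dotv -scalemxAl mxE. Qed.

Lemma dotv_ge0 x : 0 <= dotv x x.
Proof. by rewrite dotvE; apply: sumr_ge0 => i _; rewrite -expr2 sqr_ge0. Qed.

Lemma enorm1 u : enorm u = 1 -> dotv u u = 1.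
Proof. by move=> u1; rewrite -(sqr_sqrtr (dotv_ge0 u)) -/(enorm u) u1 expr1n. Qed.

Lemma enormZ (a : R) x : enorm (a *: x) = `|a| * enorm x.
Proof.
rewrite /enorm (_ : dotv _ _ = a ^+ 2 * dotv x x).
  by rewrite sqrtrM ?sqr_ge0// sqrtr_sqr.
by rewrite !dotvE mulr_sumr; apply: eq_bigr => i _; rewrite !mxE; ring.
Qed.

Lemma dotv_le_enorm x u : dotv u u = 1 -> `|dotv x u| <= enorm x.
Proof.
move=> u1; rewrite -sqrtr_sqr /enorm ler_wsqrtr// -[leRHS]mulr1 -u1 !dotvE.
have := cauchy_schwarz_sum (fun i => x ord0 i) (fun i => u ord0 i).
by move/le_trans; apply; rewrite le_eqVlt; apply/orP; left; apply/eqP.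
Qed.

Lemma eball_width D (b : 'rV[R]_d) (r : R) x y u : D `<=` eball b r ->
  dotv u u = 1 -> D x -> D y -> `|dotv (y - x) u| <= 2 * r.
Proof.
move=> Db u1 /Db xb /Db yb.
rewrite (_ : y - x = (y - b) - (x - b)); last by rewrite opprB addrA subrK.
rewrite dotvBl mulr_natl mulr2n (le_trans (ler_normB _ _))//.
by apply: lerD; apply: le_trans (dotv_le_enorm _ u1) _.
Qed.

Lemma interior_notin_boundary D x : (D `\` boundary D) x -> interior D x.
Proof.
move=> [Dx nbx]; apply: contrapT => nix; apply: nbx; split=> //.
exact: subset_closure.
Qed.

(* The last point of [D] on the ray would be a boundary point closer than [eta]. *)
Lemma ray_in_body D x u (eta : R) : closed D -> D x -> dotv u u = 1 -> 0 <= eta ->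
  eta < dist_set x (boundary D) -> D (x + eta *: u).
Proof.
move=> cD Dx u1 eta0 etad.
pose A := [set s : R | 0 <= s <= eta /\ D (x + s *: u)].
have A0 : A 0 by split; [rewrite lexx|rewrite scale0r addr0].
have Aub : has_ubound A by exists eta => s [/andP[]].
have cf : continuous (fun s : R => x + s *: u).
  by move=> s; apply: cvgD; [exact: cvg_cst|exact: scalel_continuous].
have cA : closed A.
  rewrite (_ : A = `[0, eta]%classic `&` (fun s : R => x + s *: u) @^-1` D).
    apply: closedI; first exact: itv_closed.
    by apply: preimage_closed => // s _; exact: cf.
  by apply/seteqP; split=> s /=; rewrite in_itv.
have A_sup : A (sup A) by apply: cA; apply: closure_sup => //; exists 0.
have [/andP[s0 seta] Ds] := A_sup.
have [intD|nintD] := pselect (interior D (x + sup A *: u)); last first.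
  exfalso; move: etad; apply/negP; rewrite -leNgt; apply: le_trans seta.
  apply: ge_inf.
    by exists 0 => _ [y _ <-]; exact: sqrtr_ge0.
  exists (x + sup A *: u); first by split=> //; exact: subset_closure.
  rewrite opprD addrA subrr add0r -scaleNr enormZ normrN ger0_norm//.
  by rewrite /enorm u1 sqrtr1 mulr1.
have /nbhs_ballP[e /= e0 eD] := cf (sup A) _ intD.
(* A step past [sup A] that stays in [D] and does not exceed [eta]; it cannot be a real advance, so
   [sup A] is [eta]. *)
set m := Num.min (sup A + e / 2) eta.
have e2 : 0 < e / 2 by rewrite divr_gt0.
have sm : sup A <= m by rewrite le_min seta lerDl ltW.
have me : m <= sup A + e / 2 by rewrite ge_min lexx.
have mA : m <= sup A.
  apply: ub_le_sup => //; split; first by rewrite (le_trans s0 sm)/= ge_min lexx orbT.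
  by apply: eD; rewrite /ball/= ltr_distlC; apply/andP; split; lra.
have : m = eta by move: mA me; rewrite /m; case: (leP (sup A + e / 2) eta) => //; lra.
by move=> mE; rewrite (_ : eta = sup A)//; apply/eqP; rewrite eq_le seta -mE mA.
Qed.

End euclidean_geometry.

(** * Orthonormal coordinates adapted to the direction [u] *)

Section frame.
Context {R : realType} {k : nat}.
Variables (u : 'rV[R]_k.+1) (B : 'M[R]_(k, k.+1)).
Hypotheses (u1 : dotv u u = 1) (fB : B *m B^T = 1%:M) (Bu : B *m u^T = 0).

Lemma frame_unitary :
  (col_mx u B : 'M[R]_(1 + k)) *m (col_mx u B : 'M[R]_(1 + k))^T = 1%:M.
Proof.
rewrite tr_col_mx mul_col_row fB Bu.
have -> : u *m B^T = 0 by rewrite -[LHS]trmxK trmx_mul trmxK Bu trmx0.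
have -> : u *m u^T = 1%:M by rewrite [LHS]mx11_scalar -/(dotv u u) u1.
by rewrite -scalar_mx_block.
Qed.

Lemma frame_decomp (y : 'rV[R]_k.+1) : y = dotv y u *: u + (y *m B^T) *m B.
Proof.
have := mulmx1C frame_unitary; rewrite tr_col_mx mul_row_col => E.
rewrite -[LHS]mulmx1 -[X in y *m X]E mulmxDr !mulmxA; congr (_ + _).
by rewrite [y *m u^T]mx11_scalar mul_scalar_mx.
Qed.

Lemma norm_det_frame : `|\det (col_mx u B : 'M[R]_(1 + k))| = 1.
Proof.
have := congr1 determinant frame_unitary; rewrite det_mulmx det_tr det1 => E.
by apply/eqP; rewrite -(@eqrXn2 _ 2)// -normrX expr2 E normr1 expr1n.
Qed.

Lemma frame_coordinates (y : 'rV[R]_k.+1) :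
  y *m (col_mx u B : 'M[R]_(1 + k))^T = cons_rV (dotv y u, y *m B^T).
Proof.
rewrite tr_col_mx cons_rVE -[LHS]/(y *m row_mx u^T B^T) mul_mx_row; congr row_mx.
by rewrite [LHS]mx11_scalar.
Qed.

Lemma frame_row_norm i : dotv (row i B) (row i B) = 1.
Proof.
transitivity ((B *m B^T) i i); last by rewrite fB mxE eqxx.
by rewrite dotvE [RHS]mxE; apply: eq_bigr => j _; rewrite !mxE.
Qed.

Lemma frame_coord (y : 'rV[R]_k.+1) i : (y *m B^T) ord0 i = dotv y (row i B).
Proof. by rewrite dotvE mxE; apply: eq_bigr => j _; rewrite !mxE. Qed.

End frame.

(** The form that serves both bounds: one coordinate is the depth, the others are lateral
    coordinates [S] plus a multiple [w] of the height. The matrix is orthogonal times block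
    triangular, so only $|\det S|$ survives. *)
Lemma christoffel_le_frame (R : realType) (k : nat) (sg C0 : R) :
  0 < sg -> 0 < C0 -> exists2 C : R, 0 < C &
  forall (D : set 'rV[R]_k.+1) (x u : 'rV[R]_k.+1) (B : 'M[R]_(k, k.+1)) (n N : nat)
      (phi : 'I_N -> mpoly.mpoly k.+1 R) (t0 : R) (S : 'M[R]_k) (w b : 'rV[R]_k),
    compact D -> (0 < n)%N -> orthonormal_basis D n phi ->
    dotv u u = 1 -> @orthonormal_frame R k.+1 u B ->
    S \in unitmx -> sg * n%:R ^- 2 <= t0 <= C0 ->
    (forall j, sg * n%:R ^- 2 <= b ord0 j <= C0) ->
    (forall y, D y -> 0 <= t0 - dotv (y - x) u <= C0) ->
    (forall y, D y -> forall j,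
      0 <= dotv (y - x) u * w ord0 j + ((y - x) *m B^T *m S) ord0 j + b ord0 j <= C0) ->
    christoffel phi x <=
      C * n%:R ^- k.+1 * (Num.sqrt t0 * \prod_j Num.sqrt (b ord0 j)) / `|\det S|.
Proof.
move=> sg0 C00; have [C C_gt0 HC] := christoffel_le_affine (ltn0Sn k) sg0 C00.
exists C => // D x u B n N phi t0 S w b cD n0 orth u1 [fB Bu] uS t0C bC Dt Dl.
pose Q : 'M[R]_(1 + k) := col_mx u B.
pose T : 'M[R]_(1 + k) := block_mx (-1)%:M w 0 S.
have detT : \det T = - \det S by rewrite /T det_ublock det_scalar1 mulN1r.
have uA : Q^T *m T \in unitmx.
  rewrite unitmx_mul unitmx_tr; apply/andP; split.
    by have [] := mulmx1_unit (frame_unitary u1 fB Bu).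
  by rewrite unitmxE detT unitrN -unitmxE.
have := HC D x n N phi (Q^T *m T) (cons_rV (t0, b)) cD n0 orth uA.
rewrite det_mulmx det_tr detT normrM normrN norm_det_frame// mul1r.
have -> : \prod_j Num.sqrt (cons_rV (t0, b) ord0 j) =
    Num.sqrt t0 * \prod_j Num.sqrt (b ord0 j).
  rewrite big_ord_recl cons_rV0; congr (_ * _).
  by apply: eq_bigr => j _; rewrite cons_rVS.
apply.
  move=> j; case: (unliftP ord0 j) => [i|] ->; first by rewrite cons_rVS.
  by rewrite cons_rV0.
move=> y Dy j; rewrite mulmxA frame_coordinates cons_rV_affine_block.
case: (unliftP ord0 j) => [i|] ->.
  have := Dl y Dy i; rewrite cons_rVK cons_rVS/= !mxE addrA.
  by rewrite (addrC (dotv _ _ * _)).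
have := Dt y Dy; rewrite !cons_rV0/= mulmx0 [X in _ + (X + _)]mxE add0r.
by rewrite mulN1r addrC.
Qed.

Lemma convex_set_comb (R : realType) d (D : set 'rV[R]_d) (y z : 'rV[R]_d) (l : R) :
  convex_set D -> D y -> D z -> 0 <= l <= 1 -> D (l *: y + (1 - l) *: z).
Proof.
move=> cD Dy Dz /andP[l0 l1].
have := cD y z (Itv01 l0 l1); rewrite !inE => /(_ Dy Dz).
by [].
Qed.

(* A point of [D] is joined to the apex [x + delta *: u] if it lies deeper than [x],
   and to [x - eta *: u] otherwise; the segment crosses the hyperplane of [x]. *)
Lemma slice_scaling (R : realType) k (D : set 'rV[R]_k.+1) (x u y : 'rV[R]_k.+1)
    (B : 'M[R]_(k, k.+1)) (delta eta : R) :
  convex_set D -> dotv u u = 1 -> @orthonormal_frame R k.+1 u B ->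
  0 < delta -> 0 < eta -> D (x + delta *: u) -> D (x - eta *: u) ->
  D y -> dotv (y - x) u <= delta ->
  exists l : R, [/\ 0 < l, l^-1 <= (1 + delta / eta) * (1 + (delta - dotv (y - x) u) / delta) &
    D (x + (l *: ((y - x) *m B^T)) *m B)].
Proof.
move=> cD u1 [fB Bu] delta0 eta0 Dp Dw Dy tdelta.
set a := dotv (y - x) u in tdelta *.
have yE : y = x + (a *: u + (y - x) *m B^T *m B).
  by rewrite -(frame_decomp u1 fB Bu) addrC subrK.
(* The last condition says that the components along [u] cancel, so the combination lands in the
   hyperplane of [x]. *)
have key l s : 0 < l <= 1 -> D (x + s *: u) -> l * a + (1 - l) * s = 0 ->
    D (x + (l *: ((y - x) *m B^T)) *m B).
  move=> /andP[l0 l1] Ds las.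
  have /(convex_set_comb cD Dy Ds) : 0 <= l <= 1 by rewrite ltW.
  rewrite {1}yE; set v := (y - x) *m B^T *m B.
  rewrite -scalemxAl -/v (_ : l *: _ + _ = x + (l * a + (1 - l) * s) *: u + l *: v).
    by rewrite las scale0r addr0.
  by clearbody v; apply/rowP => i; rewrite !mxE; ring.
have d1 : 1 <= 1 + delta / eta by rewrite lerDl divr_ge0// ltW.
have t1 : 0 <= (delta - a) / delta by rewrite divr_ge0 ?subr_ge0// ltW.
(* The two cases give $l^{-1}=(\delta-a)/\delta$ and $l^{-1}=1+a/\eta\le 1+\delta/\eta$; the product
   in the statement majorizes both. *)
have [a0|a0] := lerP a 0.
  have da : 0 < delta - a by lra.
  exists (delta / (delta - a)); split; first by rewrite divr_gt0.
    by rewrite invf_div -[leLHS]mul1r; apply: ler_pM => //; rewrite lerDr.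
  apply: (key _ delta) => //; last by field; rewrite gt_eqF.
  by rewrite divr_gt0//= ler_pdivrMr//; lra.
have ea : 0 < eta + a by lra.
exists (eta / (eta + a)); split; first by rewrite divr_gt0.
  rewrite invf_div mulrDl divff ?gt_eqF// -[leLHS]mulr1; apply: ler_pM => //.
  - by rewrite addr_ge0// divr_ge0// ltW.
  - by rewrite lerD2l ler_pM2r ?invr_gt0.
  - by rewrite lerDl.
apply: (key _ (- eta)); rewrite ?scaleNr//; last by field; rewrite gt_eqF.
by rewrite divr_gt0//= ler_pdivrMr//; lra.
Qed.

Lemma convex_mean (R : realType) k m (K : set 'rV[R]_k) (p : 'I_m.+1 -> 'rV[R]_k) :
  (forall y z l, K y -> K z -> 0 <= l <= 1 -> K (l *: y + (1 - l) *: z)) ->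
  (forall i, K (p i)) -> K (m.+1%:R^-1 *: \sum_i p i).
Proof.
move=> convK; elim: m p => [|m IH] p Kp.
  by rewrite big_ord1 invr1 scale1r.
have m0 : m.+1%:R != 0 :> R by rewrite pnatr_eq0.
have m1 : m.+2%:R != 0 :> R by rewrite pnatr_eq0.
rewrite big_ord_recl scalerDr.
have -> : m.+2%:R^-1 *: \sum_(i < m.+1) p (lift ord0 i) =
    (1 - m.+2%:R^-1) *: (m.+1%:R^-1 *: \sum_(i < m.+1) p (lift ord0 i)).
  rewrite scalerA; congr (_ *: _).
  rewrite -(natr1 m.+1) in m1 *; move: (m.+1%:R : R) m0 m1 => b b0 b1.
  by field; rewrite b0 b1.
by apply: convK => //; [exact: IH|rewrite invr_ge0 ler0n invf_le1 ?ler1n ?ltr0n].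
Qed.

(** The point [a *m v] is the mean of the [k] points $(ka_i)v_i$, each on the segment from 0 to
    $v_i$; hence the side $1/k$. *)
Lemma convex_parallelepiped (R : realType) k (K : set 'rV[R]_k) (v : 'M[R]_k) (a : 'rV[R]_k) :
  (forall y z l, K y -> K z -> 0 <= l <= 1 -> K (l *: y + (1 - l) *: z)) ->
  K 0 -> (forall i, K (row i v)) -> (forall i, 0 <= a ord0 i <= k%:R^-1) ->
  K (a *m v).
Proof.
case: k K v a => [|k] K v a convK K0 Kv ak.
  by rewrite (_ : a *m v = 0)//; apply/rowP => -[].
have k0 : k.+1%:R != 0 :> R by rewrite pnatr_eq0.
rewrite mulmx_sum_row (_ : \sum_i _ =
    k.+1%:R^-1 *: \sum_i (k.+1%:R * a ord0 i) *: row i v); last first.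
  by rewrite scaler_sumr; apply: eq_bigr => i _; rewrite scalerA mulKf.
apply: convex_mean => // i; have /andP[a0 a1] := ak i.
rewrite -[_ *: _]addr0 -(scaler0 _ (1 - k.+1%:R * a ord0 i)).
apply: convK => //; rewrite mulr_ge0//= -ler_pdivlMl ?ltr0Sn//.
by rewrite mulr1.
Qed.

(** The exponent is $1/2-k/2$; natural powers of a square root are what the comparison of constants
    needs. *)
Lemma powR_1B_half (R : realType) k (t : R) : 0 < t ->
  t `^ (1 - k.+1%:R / 2) = Num.sqrt t / Num.sqrt t ^+ k.
Proof.
move=> t0.
have -> : 1 - k.+1%:R / 2 = 2^-1 - 2^-1 * k%:R :> R by rewrite -natr1; field.
rewrite powRD ?(gt_eqF t0) ?implybT// powRN powRrM powR_mulrn ?powR_ge0//.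
by rewrite powR12_sqrt// ltW.
Qed.

(** * The lateral bound and the bound by the section *)

Theorem theorem1p7 (R : realType) (d : nat) (r Rad nu sigma : R)
    (hd : (0 < d)%N) (hr : 0 < r) (hRad : 0 < Rad) (hnu : 1 <= nu)
    (hsigma : 0 < sigma) :
  exists2 c : R, 0 < c &
    forall (D : set 'rV[R]_d) (x u : 'rV[R]_d) (delta : R) (n : nat),
      convex_body D ->
      (exists a : 'rV[R]_d, eball a r `<=` D) ->
      (exists b : 'rV[R]_d, D `<=` eball b Rad) ->
      (D `\` boundary D) x ->
      enorm u = 1 ->
      is_max [set t : R | D (x + t *: u)] delta ->
      delta <= nu * dist_set x (boundary D) ->
      supporting_hyperplane D (x + delta *: u) u ->
      (0 < n)%N ->
      sigma * n%:R ^- 2 <= delta ->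
      forall (N : nat) (phi : 'I_N -> mpoly.mpoly d R) (B : 'M[R]_(d.-1, d)),
        orthonormal_basis D n phi ->
        orthonormal_frame u B ->
        ((christoffel phi x)%:E <=
         (c * n%:R ^- d)%:E *
         Order.min (Num.sqrt delta)%:E
           ((delta `^ (1 - d%:R / 2))%:E *
            hyperplane_volume x B (hyperplane_section D x u)))%E.
Proof.
case: d hd => // k _.
(* The minimum with [Rad] makes the offset [3 * Rad] admissible as a peak. The largest coordinate is
   at most $4\delta-2a$, where $a$ is the height of [y] over [x]; with $\delta\le 2\,$[Rad] and
   $-a\le 2\,$[Rad] this is $12\,$[Rad]. *)
pose sg := Num.min sigma Rad; pose C0 : R := 12 * Rad.
have sg0 : 0 < sg by rewrite lt_min hsigma.
have C00 : 0 < C0 by rewrite mulr_gt0.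
have [C C_gt0 HC] := christoffel_le_frame k sg0 C00.
pose kappa : R := 1 + 2 * nu.
have kappa0 : 0 < kappa by rewrite /kappa; lra.
pose c1 := C * Num.sqrt (3 * Rad) ^+ k.
(* Per lateral coordinate: $\sqrt2$ from the peak at $2\delta$, [2 * kappa] from the scaling in [S],
   and [k] from the side $1/k$ of the parallelepiped. *)
pose c2 := C * (Num.sqrt 2 * (2 * kappa) * k%:R) ^+ k.
have c10 : 0 < c1 by rewrite mulr_gt0// exprn_gt0// sqrtr_gt0 mulr_gt0.
have c20 : 0 <= c2.
  by apply: mulr_ge0; [exact: ltW|apply: exprn_ge0; rewrite !mulr_ge0 ?sqrtr_ge0// ltW].
exists (c1 + c2); first by rewrite ltr_wpDr.
move=> D x u delta n [convD cD _] _ [b0 Db] Dx /enorm1 u1 [Dp _] dnu [_ supp].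
move=> n0 sdelta N phi B orth frame; have [fB Bu] := frame.
have n0R : 0 < n%:R :> R by rewrite ltr0n.
have clD : closed D by exact: compact_closed (@norm_hausdorff _ _) cD.
have intx := interior_notin_boundary Dx.
have {}Dx : D x by have [] := Dx.
have width y e : dotv e e = 1 -> D y -> `|dotv (y - x) e| <= 2 * Rad.
  by move=> e1 Dy; exact: eball_width Db e1 Dx Dy.
have delta0 : 0 < delta by rewrite (lt_le_trans _ sdelta)// divr_gt0// exprn_gt0.
have dE y : dotv (y - (x + delta *: u)) u = dotv (y - x) u - delta.
  by rewrite opprD addrA dotvBl dotvZl u1 mulr1.
(* The other orientation of the supporting hyperplane fails at [x] itself, where it would say
   $-\delta\ge 0$. *)
have tdelta y : D y -> dotv (y - x) u <= delta.
  have [Dn|Dp'] := supp; first by move=> /Dn/=; rewrite dE subr_le0.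
  by have := Dp' x Dx; rewrite /= (dE x) (dotvBl x x) => h; exfalso; move: h delta0; lra.
have delta_le : delta <= 2 * Rad.
  have := width _ _ u1 Dp.
  by rewrite addrC addKr dotvZl u1 mulr1 gtr0_norm.
have tC y : D y -> 0 <= delta - dotv (y - x) u <= C0.
  move=> Dy; have := width y u u1 Dy; rewrite ler_norml /C0 => /andP[w1 w2].
  by have := tdelta y Dy; move=> ?; apply/andP; split; lra.
have n2 : n%:R ^- 2 <= 1 :> R.
  by rewrite invf_le1 ?exprn_gt0// exprn_ege1// ler1n.
have sgdelta : sg * n%:R ^- 2 <= delta.
  apply: le_trans sdelta; rewrite ler_pM2r ?invr_gt0 ?exprn_gt0//.
  by rewrite ge_min lexx.
have sgRad : sg * n%:R ^- 2 <= Rad.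
  rewrite -[leRHS]mulr1; apply: ler_pM => //; first exact: ltW.
  by rewrite ge_min lexx orbT.
have nd0 : 0 < n%:R ^- k.+1 :> R by rewrite invr_gt0 exprn_gt0.
(* Lateral coordinates relative to [x] are at most [2 * Rad] in size, so the shift by [3 * Rad] puts
   them between [Rad] and [5 * Rad]. *)
have bound1 : christoffel phi x <= c1 * n%:R ^- k.+1 * Num.sqrt delta.
  have := HC D x u B n N phi delta 1%:M 0 (const_mx (3 * Rad)) cD n0 orth u1 frame.
  rewrite unitmx1 det1 normr1 divr1 => /(_ erefl).
  under eq_bigr do rewrite mxE.
  rewrite prodr_const card_ord (_ : c1 * _ * _ = C * n%:R ^- k.+1 *
    (Num.sqrt delta * Num.sqrt (3 * Rad) ^+ k)); last first.
    by rewrite /c1; ring.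
  apply => //.
  - by rewrite sgdelta /C0; lra.
  - by move=> j; rewrite mxE /C0; apply/andP; split; lra.
  - move=> y Dy j; rewrite mulmx1 !mxE mulr0 add0r.
    have := width y (row j B) (frame_row_norm fB j) Dy.
    rewrite -frame_coord mxE ler_norml /C0 => /andP[? ?]; apply/andP; split; lra.
have [e e0 eD] : exists2 e : R, 0 < e & forall i, D (x + (e *: delta_mx ord0 i) *m B).
  have /nbhs_ballP[h /= h0 hD] := intx; exists (h / 2); first by rewrite divr_gt0.
  move=> i; apply: hD; split => // a j; rewrite ord1 {a} /ball/=.
  rewrite -scalemxAl -rowE !mxE opprD addrA subrr sub0r normrN normrM.
  have Bij : `|B i j| <= 1.
    rewrite -(@expr_le1 _ 2)// real_normK ?num_real//.
    have := frame_row_norm fB i; rewrite dotvE (bigD1 j)//= !mxE -expr2 => <-.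
    by rewrite lerDl; apply: sumr_ge0 => l _; rewrite -expr2 sqr_ge0.
  by rewrite gtr0_norm ?divr_gt0//; nra.
pose K := [set z : 'rV[R]_k | D (x + z *m B)].
have KM z : K z -> forall i, `|z ord0 i| <= 2 * Rad.
  move=> Kz i; have := width _ _ (frame_row_norm fB i) Kz.
  by rewrite addrC addKr -frame_coord -mulmxA fB mulmx1.
have [v [uv vK v2]] := near_auerbach KM e0 eD.
have mD := compact_measurable_rV cD.
have mK : measurable K.
  rewrite (_ : K = (fun z => z *m B + x) @^-1` D).
    by rewrite -[X in measurable X]setTI; exact: (measurable_affine_rV B x).
  by apply/seteqP; split=> z; rewrite /K/= addrC.
have volE : hyperplane_volume x B (hyperplane_section D x u) = lebesgue_rV R k K.
  congr (lebesgue_rV _ _ _); apply/seteqP; split=> z /=; first by case.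
  move=> Kz; split => //=.
  rewrite opprD addrA subrr sub0r -scaleN1r dotvZl /dotv -mulmxA Bu mulmx0 mxE.
  by rewrite mulr0.
have vol : ((`|\det v| * (k%:R^-1) ^+ k)%:E <=
    hyperplane_volume x B (hyperplane_section D x u))%E.
  rewrite volE; apply: parallelepiped_volume_le => //.
  move=> a; apply: (convex_parallelepiped (K := K)) => //; last by rewrite /K/= mul0mx addr0.
  move=> y z l Ky Kz l01; rewrite /K/=.
  have := convex_set_comb convD Ky Kz l01; congr D.
  rewrite mulmxDl -!scalemxAl; move: (y *m B) (z *m B) => y' z'.
  by apply/rowP => i; rewrite !mxE; ring.
(* Half of $\delta/\nu$, hence strictly less than the distance to the boundary, as stepping back
   from [x] inside [D] requires. *)
pose eta := delta / (2 * nu).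
have nu0 : 0 < nu by lra.
have eta0 : 0 < eta by rewrite divr_gt0// mulr_gt0.
have etad : eta < dist_set x (boundary D).
  rewrite /eta ltr_pdivrMr ?mulr_gt0//; move: dnu delta0; nra.
have Dw : D (x - eta *: u).
  rewrite -scalerN; apply: ray_in_body => //; last exact: ltW.
  by rewrite -u1 !dotvE; apply: eq_bigr => i _; rewrite !mxE mulrNN.
have kappaE : 1 + delta / eta = kappa by rewrite /eta /kappa; field; rewrite !gt_eqF.
have slice y j : D y -> `|((y - x) *m B^T *m invmx v) ord0 j| <=
    2 * kappa * (1 + (delta - dotv (y - x) u) / delta).
  move=> Dy.
  have [l [l0 lV Dl]] := slice_scaling convD u1 frame delta0 eta0 Dp Dw Dy (tdelta y Dy).
  have := v2 _ Dl j; rewrite -scalemxAl mxE normrM gtr0_norm// mulrC -ler_pdivlMr//.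
  move=> /le_trans; apply; rewrite -mulrA ler_wpM2l//.
  by rewrite -kappaE.
have dk0 : 0 < delta / (2 * kappa) by rewrite divr_gt0// mulr_gt0.
have dv0 : 0 < `|\det v| by rewrite normr_gt0 -unitfE -unitmxE.
(* This scale turns the bound [slice] into $2\delta-a$, with $a$ the height over [x]. Taking [w]
   constant $-1$ and [b] constant $2\delta$ adds exactly $2\delta-a$, so the coordinates are
   nonnegative. *)
pose S : 'M[R]_k := delta / (2 * kappa) *: invmx v.
have detS : `|\det S| = (delta / (2 * kappa)) ^+ k / `|\det v|.
  by rewrite /S detZ det_inv normrM normfV normrX gtr0_norm.
have uS : S \in unitmx.
  by rewrite unitmxE unitfE -normr_gt0 detS divr_gt0// exprn_gt0.
have bound2 : christoffel phi x <= c2 * n%:R ^- k.+1 *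
    (delta `^ (1 - k.+1%:R / 2) * (`|\det v| * k%:R^-1 ^+ k)).
  have -> : c2 * n%:R ^- k.+1 *
      (delta `^ (1 - k.+1%:R / 2) * (`|\det v| * k%:R^-1 ^+ k)) =
      C * n%:R ^- k.+1 * (Num.sqrt delta *
        \prod_j Num.sqrt ((const_mx (2 * delta) : 'rV[R]_k) ord0 j)) / `|\det S|.
    rewrite detS; under eq_bigr do rewrite mxE.
    rewrite prodr_const card_ord sqrtrM// (powR_1B_half _ delta0) /c2.
    (* For $k=0$ both powers are 1, although [0^-1] is 0. *)
    have kk : k%:R ^+ k * k%:R^-1 ^+ k = 1 :> R.
      case: (k) => [|m]; first by rewrite !expr0 mulr1.
      by rewrite -exprMn divff ?expr1n// pnatr_eq0.
    have q0 : Num.sqrt delta != 0 by rewrite gt_eqF// sqrtr_gt0.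
    have dQ : delta ^+ k = Num.sqrt delta ^+ k * Num.sqrt delta ^+ k.
      by rewrite -exprMn -expr2 sqr_sqrtr// ltW.
    rewrite expr_div_n dQ (exprMn k (Num.sqrt 2 * (2 * kappa))).
    rewrite !(exprMn k (Num.sqrt 2)).
    move: (expf_neq0 k q0) (expf_neq0 k (lt0r_neq0 (mulr_gt0 (ltr0Sn R 1) kappa0))) kk dv0.
    move: (Num.sqrt delta ^+ k) ((2 * kappa) ^+ k) (k%:R ^+ k) (k%:R^-1 ^+ k).
    move: (Num.sqrt 2 ^+ k) (n%:R ^- k.+1) => a m Q b K1 K2 Q0 bn0 kk dv.
    rewrite (_ : _ * _ * m * _ = C * (a * b) * (K1 * K2) * m *
      (Num.sqrt delta / Q) * `|\det v|); last by ring.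
    rewrite kk; field.
    by rewrite bn0 Q0 gt_eqF.
  apply: (HC D x u B n N phi delta S (const_mx (-1)) (const_mx (2 * delta))) => //.
  - by rewrite sgdelta /C0; lra.
  - by move=> j; rewrite mxE /C0; apply/andP; split; lra.
  - move=> y Dy j; have := slice y j Dy.
    have -> : ((y - x) *m B^T *m S) ord0 j =
        delta / (2 * kappa) * ((y - x) *m B^T *m invmx v) ord0 j.
      by rewrite -scalemxAr mxE.
    move: (_ ord0 j) => z; rewrite !mxE; have /andP[a0 _] := tC y Dy.
    have := width y u u1 Dy; move: (dotv (y - x) u) a0 => a a0.
    rewrite !ler_norml /C0 => /andP[w1 _] /andP[z1 z2].
    have zE : delta / (2 * kappa) * (2 * kappa * (1 + (delta - a) / delta)) = 2 * delta - a.
      by field; rewrite !gt_eqF.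
    have z1' : - (2 * delta - a) <= delta / (2 * kappa) * z.
      by rewrite -zE -mulrN ler_wpM2l// ltW.
    have z2' : delta / (2 * kappa) * z <= 2 * delta - a.
      by rewrite -zE ler_wpM2l// ltW.
    by apply/andP; split; lra.
have cn0 : 0 <= n%:R ^- k.+1 :> R by exact: ltW.
case: (leP (Num.sqrt delta)%:E) => _.
  rewrite -EFinM lee_fin; apply: le_trans bound1 _.
  by rewrite ler_wpM2r ?sqrtr_ge0// ler_wpM2r// lerDl.
apply: (@le_trans _ _ ((c1 + c2) * n%:R ^- k.+1 *
    (delta `^ (1 - k.+1%:R / 2) * (`|\det v| * k%:R^-1 ^+ k)))%:E).
  rewrite lee_fin (le_trans bound2)// ler_wpM2r//.
    by rewrite mulr_ge0 ?powR_ge0// mulr_ge0// exprn_ge0// invr_ge0.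
  by rewrite ler_wpM2r// lerDr ltW.
rewrite EFinM lee_wpmul2l//; first by rewrite lee_fin mulr_ge0// addr_ge0// ltW.
by rewrite EFinM lee_wpmul2l// lee_fin powR_ge0.
Qed.
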